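(* Let $f:\mathbb{R}\to\mathbb{R}$ be a Lipschitz continuous, 1-periodic function which is exactly 1-periodic, in the sense that $f(\cdot-\theta)\neq f(\cdot-\theta^* )$ on a set of positive Lebesgue measure whenever $\theta\neq\theta^*\bmod 1$. Let $Z_1,\dots,Z_n$ be iid with an even density $\phi$ and distribution function $\Phi$, and observe $Y_i=f(x_i-\theta^* )+Z_i$, $i=1,\dots,n$, where $x_i:=i/n$. Let $\Phi_2(t):=\int_{-\infty}^\infty\Phi(t+z)\phi(z)\,dz$ and $$M(\theta):=\int_0^1\!\!\int_0^1 \Phi_2\big(f(x_0)-f(x)\big)\, f(x_0+\theta^*-\theta)\,dx\,dx_0,$$ and assume that $\theta^*$ is the unique maximum point of $M$ modulo 1. Let $R_i$ be the rank of $Y_i$ among $Y_1,\dots,Y_n$ and let $\hat\theta_n$ be a maximizer over $\theta$ of $\widehat M_n(\theta):=\frac1n\sum_{i=1}^n\frac{R_i}{n}f(x_i-\theta)$. Then $\hat\theta_n$ is $\sqrt n$-consistent: $\sqrt n\, d(\hat\theta_n,\theta^* )$ is bounded in probability, where $d$ denotes the distance modulo 1 (distance in $\mathbb{R}/\mathbb{Z}$).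
   Context: $\hat\theta_n$ is the rank-based (R-)estimator of the shift; the shift is identified only modulo 1. *)

(* Defs.v *)
From HB Require Import structures.
From mathcomp Require Import all_boot all_order all_algebra.
From mathcomp Require Import all_classical all_reals all_analysis.
Set Implicit Arguments. Unset Strict Implicit. Unset Printing Implicit Defensive.
Import Order.TTheory GRing.Theory Num.Theory.
Import numFieldNormedType.Exports.
Local Open Scope classical_set_scope.
Local Open Scope ring_scope.

Definition dmod1 {R : realType} (a b : R) : R :=
  let t := a - b in
  let fr := t - (Num.floor t)%:~R in
  Num.min fr (1 - fr).

Definition mutually_independent {d} {T : measurableType d} {R : realType}
  (P : probability T R) (Z : nat -> {RV P >-> R}) : Prop :=
  forall (I : seq nat) (A : nat -> set R), uniq I ->
    (forall i, measurable (A i)) ->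
    P (\bigcap_(i in [set` I]) (Z i @^-1` A i)) =
      (\prod_(i <- I) P (Z i @^-1` A i))%E.

Definition has_density {d} {T : measurableType d} {R : realType}
  (P : probability T R) (X : {RV P >-> R}) (phi : R -> R) : Prop :=
  forall A : set R, measurable A ->
    P (X @^-1` A) = (\int[lebesgue_measure]_(x in A) (phi x)%:E)%E.

Definition cdf_of {R : realType} (phi : R -> R) (t : R) : R :=
  Rintegral lebesgue_measure `]-oo, t] phi.

Definition Phi2 {R : realType} (phi : R -> R) (t : R) : R :=
  Rintegral lebesgue_measure setT (fun z => cdf_of phi (t + z) * phi z).

Definition Mpop {R : realType} (f phi : R -> R) (thstar th : R) : R :=
  Rintegral lebesgue_measure `[0, 1] (fun x0 =>
    Rintegral lebesgue_measure `[0, 1] (fun x =>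
      Phi2 phi (f x0 - f x) * f (x0 + thstar - th))).

Definition rank {R : realType} (n : nat) (Y : nat -> R) (i : nat) : nat :=
  #|[set j : 'I_n.+1 | (0 < (j : nat))%N & Y j <= Y i]|.

Definition Mhat {R : realType} (f : R -> R) (n : nat) (Y : nat -> R) (th : R) : R :=
  n%:R^-1 * \sum_(1 <= i < n.+1)
     ((rank n Y i)%:R / n%:R) * f (i%:R / n%:R - th).

Arguments mutually_independent {d T R} P Z.
Arguments has_density {d T R} P X phi.

(* Main.v *)
(** Write [g i = f (i/n - thstar)] and [H y = n^-1 sum_j Phi2 (y - g j)].  The
mean of the criterion at [thstar - k/n] is, up to a term independent of [k],
[n^-1 sum_i H (g i) g (i + k)], and on the values of [f] the function [H]
increases at least linearly: [Phi2] has slope bounded below near [0], because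
the noise density is bounded below on a set having a Lebesgue density point.  As
[i |-> i + k] permutes the grid, the rearrangement inequality gives a drift of
at most [- c n^-1 sum_i (g (i + k) - g i)^2], and this is at most
[- c' (k/n)^2]: macroscopic shifts are handled by compactness, microscopic ones
by iterating them until they are macroscopic.

The centered ranks are only correlated through shared indices, so one grid step
changes the centered criterion by [V_l] with [E V_l^2 = O (n^-3)].  If the
estimator is [k] grid steps away from [thstar], then [c' (k/n)^2 <= sum_(l<k) V_l]
up to [O (1/n)], and for [k >= m = C0 sqrt n] the Cauchy-Schwarz inequality with
weights [(m + l)^2] turns this into a lower bound on the single random variable
[sum_l V_l^2 / (m + l)^2], to which Markov's inequality applies. *)

Require Import Defs.
From HB Require Import structures.
From mathcomp Require Import all_boot all_order all_algebra fingroup perm.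
From mathcomp Require Import all_classical all_reals all_analysis.
From mathcomp Require Import measurable_realfun ring lra zify.
Import Order.TTheory GRing.Theory Num.Theory.
Import numFieldNormedType.Exports.
Set Implicit Arguments. Unset Strict Implicit. Unset Printing Implicit Defensive.
Local Open Scope classical_set_scope.
Local Open Scope ring_scope.

(** * Sums over periodic sequences *)

Section PeriodicSums.
Variables (V : zmodType) (n : nat) (F : int -> V).
Hypothesis per : forall z, F (z + n%:Z) = F z.

Lemma periodic_shift_nat (z : int) (m : nat) : F (z + m%:Z * n%:Z) = F z.
Proof.
elim: m => [|m IHm]; first by rewrite mul0r addr0.
by rewrite -addn1 PoszD mulrDl mul1r addrA per.
Qed.

Lemma periodic_shift (z m : int) : F (z + m * n%:Z) = F z.
Proof.
case: (intP m) => [|k|k].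
- by rewrite mul0r addr0.
- exact: periodic_shift_nat.
- by rewrite -(periodic_shift_nat _ k.+1) -addrA -mulrDl addNr mul0r addr0.
Qed.

Lemma sum_periodic_shift (a : int) :
  \sum_(1 <= i < n.+1) F (a + i%:Z) = \sum_(1 <= i < n.+1) F i%:Z.
Proof.
have step (b : int) : \sum_(1 <= i < n.+1) F (b + 1 + i%:Z) =
    \sum_(1 <= i < n.+1) F (b + i%:Z).
  case: n per => [|m] perm; first by rewrite !big_nil.
  rewrite big_nat_recr //= [in RHS]big_ltn //= [RHS]addrC; congr (_ + _).
    rewrite [in RHS]big_add1 /=; apply: eq_bigr => i _; congr F.
    by rewrite -addrA -PoszD add1n.
  by rewrite -(perm (b + 1)); congr F; lia.
have nat_step (k : nat) : \sum_(1 <= i < n.+1) F (k%:Z + i%:Z) =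
    \sum_(1 <= i < n.+1) F i%:Z.
  elim: k => [|k IHk]; first by apply: eq_bigr => i _; rewrite add0r.
  by rewrite -[k.+1]addn1 PoszD step.
case: a => k; first exact: nat_step.
rewrite NegzE; elim: k => [|k IHk].
  by rewrite -step -(nat_step 0); apply: eq_bigr => i _; congr (F (_ + _)).
rewrite -step -IHk; apply: eq_bigr => i _; congr (F (_ + _)); lia.
Qed.

End PeriodicSums.

(** Induction on a set [A] outside which the permutation is the identity. Comonotonicity makes a
    maximizer [a] of [u + v] over [A] maximize [u] and [v] separately; redirecting the permutation
    to fix [a] does not decrease the sum and removes [a] from [A]. *)
Lemma rearrangement (R : realDomainType) (I : finType) (u v : I -> R)
    (s : {perm I}) :
  (forall i j, 0 <= (u i - u j) * (v i - v j)) ->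
  \sum_i u i * v (s i) <= \sum_i u i * v i.
Proof.
move=> uv.
suff H m (A : {set I}) (t : {perm I}) : (#|A| <= m)%N -> perm_on A t ->
    \sum_i u i * v (t i) <= \sum_i u i * v i.
  by apply: (H _ [set: I]%SET s (leqnn _)); apply/fintype.subsetP => x _; rewrite inE.
elim: m A t => [|m IHm] A t.
  rewrite leqn0 cards_eq0 => /eqP -> ts.
  by rewrite (_ : t = 1%g) ?lexx ?(eq_bigr _ (fun i _ => congr1 _ (congr1 v (perm1 i)))) //;
    apply/permP => x; rewrite perm1 (out_perm ts) ?inE.
move=> Am ts; have [A0|[i0 i0A]] := set_0Vmem A.
  by apply: (IHm A) => //; rewrite A0 cards0.
pose a := [arg max_(i > i0 in A) (u i + v i)]%O.
have [aA amax] : a \in A /\ forall j, j \in A -> u j + v j <= u a + v a.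
  by rewrite /a; case: arg_maxP.
have both j : j \in A -> u j <= u a /\ v j <= v a.
  move=> jA; have := amax j jA; have := uv a j => h1 h2.
  split; rewrite leNgt; apply/negP => h.
    have : 0 < (u j - u a) * (v a - v j) by rewrite mulr_gt0 //; lra.
    by lra.
  have : 0 < (v j - v a) * (u a - u j) by rewrite mulr_gt0 //; lra.
  by lra.
(* [t'] fixes [a] and sends the former preimage of [a] to [t a]. *)
pose t' := (t * tperm a (t a))%g.
have t'E x : t' x = if x == a then a else if t x == a then t a else t x.
  rewrite /t' permM; have [->|xa] := eqVneq x a; first by rewrite tpermR.
  have [->|txa] := eqVneq (t x) a; first by rewrite tpermL.
  by rewrite tpermD // eq_sym // (inj_eq perm_inj).
have ts' : perm_on (A :\ a) t'.
  apply/fintype.subsetP => x; rewrite !inE t'E; have [->|xa] := eqVneq x a; rewrite ?eqxx //=.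
  have [txa _|_ txx] := eqVneq (t x) a.
    by rewrite -(perm_closed x ts) txa.
  by apply: contraNT txx => xA; rewrite (out_perm ts xA).
have card' : (#|A :\ a| <= m)%N.
  by move: Am; rewrite (cardsD1 a A) aA add1n ltnS.
apply: le_trans (IHm _ _ card' ts').
have [taa|taa] := eqVneq (t a) a.
  rewrite le_eqVlt; apply/orP; left; apply/eqP/eq_bigr => i _.
  rewrite t'E; case: eqVneq => [->|_]; first by rewrite taa.
  by case: eqVneq => // ->; rewrite taa.
pose b := (t^-1)%g a.
have tb : t b = a by rewrite /b permKV.
have ba : b != a by apply/eqP => ba; move: taa; rewrite -{1}ba tb eqxx.
rewrite (bigD1 a) //= (bigD1 b) //= [leRHS](bigD1 a) //= [X in _ <= _ + X](bigD1 b) //=.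
rewrite !t'E eqxx (negbTE ba) tb eqxx !addrA lerD //; last first.
  rewrite le_eqVlt; apply/orP; left; apply/eqP/eq_bigr => i /andP[ia ib].
  rewrite t'E (negbTE ia); case: eqVneq => // tia.
  by move: ib; rewrite -(inj_eq (@perm_inj _ t)) tia tb eqxx.
have bA : b \in A by rewrite -(perm_closed b ts) tb.
have taA : t a \in A by rewrite perm_closed.
have [ub _] := both b bA; have [_ vt] := both _ taA.
(* This product is exactly the gain of the exchange. *)
have : 0 <= (u a - u b) * (v a - v (t a)) by rewrite mulr_ge0 ?subr_ge0.
by nra.
Qed.

Lemma rearrangement_periodic (R : realDomainType) (n : nat) (u v : int -> R)
    (k : int) :
  (forall z, u (z + n%:Z) = u z) -> (forall z, v (z + n%:Z) = v z) ->
  (forall i j, 0 <= (u i - u j) * (v i - v j)) ->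
  \sum_(1 <= i < n.+1) u i%:Z * v (i%:Z + k) <= \sum_(1 <= i < n.+1) u i%:Z * v i%:Z.
Proof.
move=> pu pv uv; case: n => [|n] in pu pv *; first by rewrite !big_nil.
have vmod z m : z = m %[mod n.+1]%Z -> v z = v m.
  move=> zm; rewrite (divz_eq z n.+1) (divz_eq m n.+1) zm.
  by rewrite ![_ * _ + _]addrC !(periodic_shift pv).
rewrite !big_add1 /= !big_mkord.
(* Modulo the period the shift is a permutation: addition of the residue [c] of [k]. *)
pose c : 'I_n.+1 := inord `|(k %% n.+1)%Z|.
have cE : (c : nat)%:Z = (k %% n.+1)%Z.
  have k0 : (0 <= (k %% n.+1)%Z) by apply: modz_ge0.
  rewrite inordK ?gez0_abs //.
  by rewrite -ltz_nat gez0_abs // ltz_pmod.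
pose s : {perm 'I_n.+1} := perm (@addIr _ c).
have := @rearrangement R _ (fun i : 'I_n.+1 => u i.+1) (fun i : 'I_n.+1 => v i.+1) s
  (fun i j => uv _ _).
congr (_ <= _); apply: eq_bigr => i _; congr (_ * _); apply: vmod.
rewrite permE /= -addn1 PoszD -modz_nat modzDml PoszD cE.
by rewrite -addrA [X in (_ + X)%R]addrC addrA modzDmr; congr (_ %% _)%Z; lia.
Qed.

(* Subtracting [c * v] from [u] leaves a function comonotone with [v], and for
   [u = c * v] the left side equals the right side. *)
Lemma strong_rearrangement (R : realFieldType) (n : nat) (u v : int -> R)
    (c : R) (k : int) :
  (forall z, u (z + n%:Z) = u z) -> (forall z, v (z + n%:Z) = v z) ->
  (forall i j, v i <= v j -> c * (v j - v i) <= u j - u i) ->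
  \sum_(1 <= i < n.+1) u i%:Z * (v (i%:Z + k) - v i%:Z) <=
  - (c / 2) * \sum_(1 <= i < n.+1) (v (i%:Z + k) - v i%:Z) ^+ 2.
Proof.
move=> pu pv uv.
have comon i j : 0 <= (u i - c * v i - (u j - c * v j)) * (v i - v j).
  case: (lerP (v i) (v j)) => [vij|/ltW vij].
    by rewrite mulr_le0 // ?subr_le0 //; have := uv _ _ vij; lra.
  by rewrite mulr_ge0 // ?subr_ge0 //; have := uv _ _ vij; lra.
have pw z : u (z + n%:Z) - c * v (z + n%:Z) = u z - c * v z by rewrite pu pv.
have := @rearrangement_periodic R n (fun z => u z - c * v z) v k pw pv comon.
have psq z : v (z + n%:Z) ^+ 2 = v z ^+ 2 by rewrite pv.
have := @sum_periodic_shift _ n (fun z => v z ^+ 2) psq k.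
under eq_bigr do rewrite addrC.
rewrite -subr_ge0 -sumrB => e h.
have -> : \sum_(1 <= i < n.+1) u i%:Z * (v (i%:Z + k) - v i%:Z) =
  - \sum_(1 <= i < n.+1) ((u i%:Z - c * v i%:Z) * v i%:Z -
                     (u i%:Z - c * v i%:Z) * v (i%:Z + k))
  - (c / 2) * \sum_(1 <= i < n.+1) (v (i%:Z + k) - v i%:Z) ^+ 2
  + (c / 2) * (\sum_(1 <= i < n.+1) v (i%:Z + k) ^+ 2
               - \sum_(1 <= i < n.+1) v i%:Z ^+ 2).
  rewrite -sumrB !mulr_sumr -!sumrN -!big_split /=; by apply: eq_bigr => i _; field.
by rewrite e subrr mulr0 addr0 mulNr gerDr oppr_le0.
Qed.

Lemma sqr_sum_le (R : realFieldType) (q : nat) (d : nat -> R) :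
  (\sum_(j < q) d j) ^+ 2 <= q%:R * \sum_(j < q) d j ^+ 2.
Proof.
elim: q => [|q IHq]; first by rewrite !big_ord0 mulr0 expr0n.
rewrite !big_ord_recr /=.
set S := \sum_(i < q) _ in IHq *; set D := \sum_(i < q) _ in IHq *.
case: q => [|q] in S D IHq *; first by rewrite /S /D !big_ord0 !add0r mul1r.
have q0 : 0 < (q.+1%:R : R) by rewrite ltr0Sn.
have qE : q.+2%:R = q.+1%:R + 1 :> R by rewrite -natr1.
rewrite qE; set x := q.+1%:R in q0 IHq *.
(* After multiplication by [x > 0] the goal follows from the induction hypothesis and this
   square. *)
have h : 0 <= (S - x * d q.+1) ^+ 2 by exact: sqr_ge0.
have D0 : 0 <= D by apply: sumr_ge0 => i _; exact: sqr_ge0.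
rewrite -(ler_pM2l q0); nra.
Qed.

(** The [q]-fold shift telescopes into [q] single shifts. Cauchy-Schwarz gives one factor [q]; by
    periodicity all single shifts have the same energy, which gives the other. *)
Lemma iterated_shift_le (R : realFieldType) (n : nat) (v : int -> R) (k : int)
    (q : nat) :
  (forall z, v (z + n%:Z) = v z) ->
  \sum_(1 <= i < n.+1) (v (i%:Z + q%:Z * k) - v i%:Z) ^+ 2 <=
  q%:R ^+ 2 * \sum_(1 <= i < n.+1) (v (i%:Z + k) - v i%:Z) ^+ 2.
Proof.
move=> pv.
have H (i : int) : (v (i + q%:Z * k) - v i) ^+ 2 <=
    q%:R * \sum_(j < q) (v (i + j%:Z * k + k) - v (i + j%:Z * k)) ^+ 2.
  have -> : v (i + q%:Z * k) - v i =
      \sum_(j < q) (v (i + j%:Z * k + k) - v (i + j%:Z * k)).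
    elim: q => [|q IHq]; first by rewrite big_ord0 mul0r addr0 subrr.
    rewrite big_ord_recr /= -IHq addrC addrA subrK -addn1 PoszD mulrDl mul1r addrA.
    by [].
  exact: (sqr_sum_le _ (fun j => v (i + j%:Z * k + k) - v (i + j%:Z * k))).
apply: (le_trans (ler_sum _ (fun i _ => H i%:Z))).
rewrite -mulr_sumr exchange_big /= expr2 -mulrA ler_wpM2l //.
rewrite (eq_bigr (fun=> \sum_(1 <= i < n.+1) (v (i%:Z + k) - v i%:Z) ^+ 2)).
  by rewrite sumr_const card_ord mulr_natl.
move=> j _.
have pd z : (v (z + n%:Z + k) - v (z + n%:Z)) ^+ 2 = (v (z + k) - v z) ^+ 2.
  by rewrite addrAC !pv.
have := @sum_periodic_shift _ n (fun z => (v (z + k) - v z) ^+ 2) pd (j%:Z * k).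
move=> <-; apply: eq_bigr => i _; by rewrite [j%:Z * k + _]addrC.
Qed.

(** * Periodic Lipschitz functions on a grid *)

Lemma periodic_int (R : realType) (V : Type) (f : R -> V) :
  (forall x, f (x + 1) = f x) -> forall x (z : int), f (x + z%:~R) = f x.
Proof.
move=> per x z; have pn (y : R) (m : nat) : f (y + m%:R) = f y.
  elim: m => [|m IHm]; first by rewrite addr0.
  by rewrite -natr1 addrA per.
case: z => m; first exact: pn.
by rewrite NegzE mulrNz -[LHS](pn _ m.+1) subrK.
Qed.

Lemma grid_periodic (R : realType) (V : Type) (f : R -> V) (n : nat) (th : R) :
  (forall x, f (x + 1) = f x) -> (0 < n)%N ->
  forall z : int, f ((z + n%:Z)%:~R / n%:R - th) = f (z%:~R / n%:R - th).
Proof.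
move=> per n0 z; rewrite intrD mulrDl divff ?pnatr_eq0 -?lt0n //.
by rewrite addrAC per.
Qed.

(** By periodicity the sum may start at the first grid point of [[x0, x0 + r]], which contains at
    least [r * n - 1 >= r * n / 2] of them; the remaining terms are nonnegative. *)
Lemma sum_grid_ge (R : realType) (G : R -> R) (n : nat) (th x0 r v : R) :
  (forall x, G (x + 1) = G x) -> (forall x, 0 <= G x) ->
  (forall x, x0 <= x <= x0 + r -> v <= G x) ->
  0 <= v -> r <= 1 -> 2 <= r * n%:R ->
  v * (r / 2) * n%:R <= \sum_(1 <= i < n.+1) G (i%:R / n%:R - th).
Proof.
move=> per G0 Gv v0 r1 rn.
have n0 : (0 < n)%N by rewrite lt0n; apply: contraTneq rn => ->; rewrite mulr0 -ltNge.
have nR : 0 < n%:R :> R by rewrite ltr0n.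
pose F (z : int) := G (z%:~R / n%:R - th).
(* In grid units the interval starts at [y], so [a + 1] is its first integer point and [a + i] stays
   inside for [1 <= i <= r * n]. *)
pose y := n%:R * (x0 + th); pose a := Num.ceil y - 1.
rewrite -(@sum_periodic_shift _ n F (grid_periodic th per n0) a).
pose q := Num.truncn (r * n%:R).
have rn0 : 0 <= r * n%:R by lra.
have /andP[q1 q2] := truncn_itv rn0; rewrite -/q in q1 q2.
have qn : (q <= n)%N.
  by rewrite -(ler_nat R); apply: le_trans q1 _; rewrite ler_piMl // ltW.
rewrite (@big_cat_nat _ _ _ q.+1) //=.
apply: (@le_trans _ _ (\sum_(1 <= i < q.+1) v)).
  rewrite sumr_const_nat subn1 /= -[v *+ q]mulr_natr -mulrA ler_wpM2l //.
  by move: q2; rewrite -natr1; lra.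
rewrite -[leLHS]addr0 lerD //; last by apply: sumr_ge0 => i _; exact: G0.
apply: ler_sum_nat => i /andP[i1 iq]; apply: Gv.
rewrite intrD intrB -pmulrn.
have /andP[c1 c2] := ceil_itv y.
have iR : 1 <= i%:R :> R by rewrite ler1n.
have iq' : i%:R <= q%:R :> R by rewrite ler_nat.
rewrite lerBrDr lerBlDr ler_pdivlMr // ler_pdivrMr //.
move: c1 c2; rewrite intrB /y => c1 c2.
by apply/andP; split; nra.
Qed.

(** The supremum [S t] of [|f (x - t) - f x|] over [x] is Lipschitz in [t], hence attains its
    minimum on the compact interval, and this minimum is positive. Half of it leaves room for a
    witness [x]. *)
Lemma shift_gap (R : realType) (f : R -> R) (L a b : R) :
  (forall x y, `|f x - f y| <= L * `|x - y|) -> a <= b ->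
  (forall t, a <= t <= b -> exists x, f (x - t) != f x) ->
  exists2 c, 0 < c & forall t, a <= t <= b -> exists x, c < `|f (x - t) - f x|.
Proof.
move=> lip ab gap.
pose A t := [set `|f (x - t) - f x| | x in [set: R]].
pose S t := sup (A t).
have A0 t : A t !=set0 by exists (`|f (0 - t) - f 0|), 0.
have Ab t : has_ubound (A t).
  exists (L * `|t|) => _ [x _ <-].
  by apply: le_trans (lip _ _) _; rewrite addrAC subrr add0r normrN.
have SL s t : S s <= S t + L * `|s - t|.
  apply: ge_sup => // _ [x _ <-].
  have h : `|f (x - t) - f x| <= S t by apply: ub_le_sup => //; exists x.
  have -> : f (x - s) - f x = f (x - t) - f x + (f (x - s) - f (x - t)) by ring.
  apply: le_trans (ler_normD _ _) _; rewrite lerD //.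
  by apply: le_trans (lip _ _) _; rewrite (_ : x - s - (x - t) = t - s) ?(distrC t) //; ring.
have SL' s t : `|S s - S t| <= L * `|s - t|.
  rewrite ler_norml; have := SL s t; have := SL t s.
  by rewrite (distrC t s) => h1 h2; apply/andP; split; lra.
have L0 : 0 <= L by have := lip 1 0; rewrite subr0 normr1 mulr1; apply: le_trans.
have L1 : 0 < L + 1 by lra.
have cS : continuous S.
  move=> t; apply/cvgrPdist_lt => e e0; near=> s.
  apply: le_lt_trans (SL' t s) _.
  have : `|t - s| < e / (L + 1).
    near: s; apply: (@cvgr_dist_lt _ _ _ (nbhs t) _ id t cvg_id); exact: divr_gt0.
  rewrite ltr_pdivlMr //.
  by have := normr_ge0 (t - s); nra.
have [c cab cmin] := @EVT_min R S a b ab (continuous_subspaceT cS).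
have [x xc] : exists x, f (x - c) != f x by apply: gap; move: cab; rewrite in_itv.
have Sc : 0 < S c.
  apply: (@lt_le_trans _ _ `|f (x - c) - f x|); first by rewrite normr_gt0 subr_eq0.
  by apply: ub_le_sup => //; exists x.
exists (S c / 2); first by rewrite divr_gt0.
move=> t tab; have h : S c / 2 < sup (A t).
  have : S c <= S t by apply: cmin; rewrite in_itv.
  by rewrite -/(S t) => ?; lra.
have [_ [z _ <-] hz] := sup_gt (A0 t) h.
by exists z.
Unshelve. all: by end_near. Qed.

Section PeriodicLipschitz.
Variables (R : realType) (f : R -> R) (L : R).
Hypothesis lip : forall x y, `|f x - f y| <= L * `|x - y|.
Hypothesis per : forall x, f (x + 1) = f x.

Lemma lipschitz_const_ge0 : 0 <= L.
Proof. by have := lip 1 0; rewrite subr0 normr1 mulr1; apply: le_trans. Qed.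

Lemma oscillation_le u v : f v - f u <= L.
Proof.
have red x : f x = f (x - (Num.floor x)%:~R) by rewrite -mulrNz periodic_int.
rewrite (red u) (red v); apply: le_trans (ler_norm _) _; apply: le_trans (lip _ _) _.
rewrite ler_piMr ?lipschitz_const_ge0 //.
have /andP[u1 u2] := floor_itv u; have /andP[v1 v2] := floor_itv v.
move: u2 v2; rewrite !intrD => u2 v2.
by rewrite ler_norml; apply/andP; split; lra.
Qed.

(** Such a shift moves [f] by more than a fixed [c] at some point, and by the Lipschitz bound by at
    least [c / 2] on an interval of fixed length [r], which contains a fixed proportion of the
    grid. *)
Lemma macroscopic_shift_energy :
  (forall t, 4^-1 <= t <= 2^-1 -> exists x, f (x - t) != f x) ->
  exists2 c, 0 < c & exists N, forall (n k : nat) (th : R), (N <= n)%N ->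
    (n <= 4 * k)%N -> (2 * k <= n)%N ->
    c * n%:R <= \sum_(1 <= i < n.+1)
      (f ((i%:Z + k%:Z)%:~R / n%:R - th) - f ((i%:Z)%:~R / n%:R - th)) ^+ 2.
Proof.
move=> gap; have L0 := lipschitz_const_ge0.
have h42 : 4^-1 <= 2^-1 :> R by lra.
have [c c0 hc] := shift_gap lip h42 gap.
(* [L * r <= c / 4]: moving by [r] costs at most [c / 4] at each of the two arguments. *)
pose r := Num.min 1 (c / (4 * (L + 1))).
have r0 : 0 < r by rewrite lt_min ltr01 divr_gt0 //; lra.
have r1 : r <= 1 by rewrite ge_min lexx.
have rc : 4 * (L * r) <= c.
  have : r <= c / (4 * (L + 1)) by rewrite ge_min lexx orbT.
  by rewrite ler_pdivlMr; [nra|lra].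
exists (c ^+ 2 / 4 * (r / 2)); first by rewrite !mulr_gt0 ?exprn_gt0 ?invr_gt0 ?ltr0n.
exists (Num.truncn (2 / r)).+1 => n k th Nn nk kn.
have rn : 2 <= r * n%:R.
  rewrite mulrC -ler_pdivrMr //; apply/ltW/(lt_le_trans (truncnS_gt _)).
  by rewrite ler_nat.
have n0 : (0 < n)%N by lia.
have nR : 0 < n%:R :> R by rewrite ltr0n.
pose t : R := k%:R / n%:R.
have [x0 hx0] : exists x, c < `|f (x - t) - f x|.
  apply: hc; rewrite /t ler_pdivlMr // ler_pdivrMr //.
  move: nk kn; rewrite -!(ler_nat R) !natrM => nk kn.
  by apply/andP; split; lra.
pose g (z : int) := f (z%:~R / n%:R - th).
have pg := grid_periodic th per n0.
have pd z : (g (z + n%:Z + k%:Z) - g (z + n%:Z)) ^+ 2 = (g (z + k%:Z) - g z) ^+ 2.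
  by rewrite /g addrAC !pg.
(* The gap is stated for [f (x - t)], so the energy is reindexed by [i - k]. *)
have := @sum_periodic_shift _ n (fun z => (g (z + k%:Z) - g z) ^+ 2) pd (- k%:Z).
rewrite /g => <-.
pose G x := (f (x - t) - f x) ^+ 2.
have := @sum_grid_ge R G n th x0 r (c ^+ 2 / 4).
have -> : \sum_(1 <= i < n.+1) G (i%:R / n%:R - th) = \sum_(1 <= i < n.+1)
    (f ((- k%:Z + i%:Z + k%:Z)%:~R / n%:R - th) - f ((- k%:Z + i%:Z)%:~R / n%:R - th)) ^+ 2.
  apply: eq_bigr => i _; rewrite /G -sqrrN opprB; congr ((f _ - f _) ^+ 2).
    by rewrite addrAC addNr add0r.
  by rewrite /t intrD mulrNz -!pmulrn; ring.
apply => //.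
- by move=> x; rewrite /G addrAC !per.
- by move=> x; exact: sqr_ge0.
- move=> x /andP[x1 x2]; rewrite /G.
  have xx0 : `|x - x0| <= r by rewrite ler_norml; apply/andP; split; lra.
  have h1 : `|f x - f x0| <= c / 4.
    by apply: le_trans (lip _ _) _; have := ler_wpM2l L0 xx0; lra.
  have h2 : `|f (x - t) - f (x0 - t)| <= c / 4.
    apply: le_trans (lip _ _) _; rewrite (_ : x - t - (x0 - t) = x - x0); last by ring.
    by have := ler_wpM2l L0 xx0; lra.
  have h : c / 2 <= `|f (x - t) - f x|.
    have : f (x0 - t) - f x0 = (f (x - t) - f x) + (f x - f x0) - (f (x - t) - f (x0 - t)).
      by ring.
    move=> e; move: hx0; rewrite e => hx0.
    have := ler_normB (f (x - t) - f x + (f x - f x0)) (f (x - t) - f (x0 - t)).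
    have := ler_normD (f (x - t) - f x) (f x - f x0).
    by lra.
  rewrite -(real_normK (num_real (f (x - t) - f x))).
  by have := normr_ge0 (f (x - t) - f x); nra.
- by rewrite divr_ge0 // sqr_ge0.
Qed.

(** Iterating the shift [q] times makes it macroscopic at the price of a factor [q ^ 2] in the
    energy; as [2 * q * k <= n], the bound [n] becomes [k ^ 2 / n] up to a constant. *)
Lemma shift_energy :
  (forall t, 4^-1 <= t <= 2^-1 -> exists x, f (x - t) != f x) ->
  exists2 c, 0 < c & exists N, forall (n k : nat) (th : R), (N <= n)%N ->
    (2 * k <= n)%N ->
    c * k%:R ^+ 2 / n%:R <= \sum_(1 <= i < n.+1)
      (f ((i%:Z + k%:Z)%:~R / n%:R - th) - f ((i%:Z)%:~R / n%:R - th)) ^+ 2.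
Proof.
move=> /macroscopic_shift_energy [c c0 [N hN]].
exists (4 * c); first by rewrite mulr_gt0.
exists (maxn N 1) => n k th; rewrite geq_max => /andP[Nn n0] kn.
have nR : 0 < n%:R :> R by rewrite ltr0n.
case: k kn => [|k'] kn; first by
  rewrite expr0n mulr0 mul0r; apply: sumr_ge0 => i _; exact: sqr_ge0.
set k := k'.+1 in kn *; have k0 : (0 < k)%N by [].
(* [n / (4 * k)] rounded up: this is [1] if [n <= 4 * k], and otherwise rounding adds less than
   [k <= n / 4] to [q * k]. *)
pose q := ((n + 4 * k - 1) %/ (4 * k))%N.
have [q1 q2] : (n <= 4 * (q * k))%N /\ (2 * (q * k) <= n)%N.
  have e := divn_eq (n + 4 * k - 1) (4 * k); rewrite -/q in e.
  have h : ((n + 4 * k - 1) %% (4 * k) < 4 * k)%N by rewrite ltn_mod muln_gt0.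
  split; first by nia.
  have [nk|nk] := leqP n (4 * k); last by nia.
  suff -> : q = 1 by lia.
  have : (q * (4 * k) <= n + 4 * k - 1)%N by rewrite e leq_addr.
  by nia.
pose g (z : int) := f (z%:~R / n%:R - th).
have := @iterated_shift_le R n g k%:Z q (grid_periodic th per n0).
have := hN n (q * k)%N th Nn q1 q2; rewrite /g PoszM => h1 h2.
have {h1 h2} h := le_trans h1 h2.
set E := \sum_(1 <= i < n.+1) _ in h *.
have E0 : 0 <= E by apply: sumr_ge0 => i _; exact: sqr_ge0.
have qk : 2 * (q%:R * k%:R) <= n%:R :> R by rewrite -!natrM ler_nat.
rewrite ler_pdivrMr // -(ler_pM2r nR).
have : c * n%:R * (4 * k%:R ^+ 2) <= q%:R ^+ 2 * E * (4 * k%:R ^+ 2).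
  by rewrite ler_wpM2r // mulr_ge0 // sqr_ge0.
move=> h'; have e2 : (2 * (q%:R * k%:R)) ^+ 2 <= n%:R ^+ 2 :> R.
  by rewrite ler_sqr ?nnegrE // ?mulr_ge0.
have := ler_wpM2r E0 e2.
by lra.
Qed.

(** All differences are nonnegative; those at grid points [x] near [u] are linear in the jump,
    because [f u - f x] is then in the window where [Psi] has slope at least [c0]. *)
Lemma smoothed_score_strongly_monotone (Psi : R -> R) (c0 dl : R) :
  0 < c0 -> 0 < dl ->
  (forall a b, a <= b -> Psi a <= Psi b) ->
  (forall a b, - dl <= a -> a <= b -> b <= dl -> c0 * (b - a) <= Psi b - Psi a) ->
  exists2 c, 0 < c & exists N, forall (n : nat) (th u v : R), (N <= n)%N ->
    f u <= f v ->
    c * (f v - f u) * n%:R <= \sum_(1 <= i < n.+1) Psi (f v - f (i%:R / n%:R - th))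
      - \sum_(1 <= i < n.+1) Psi (f u - f (i%:R / n%:R - th)).
Proof.
move=> c0_gt0 dl0 mono strong; have L0 := lipschitz_const_ge0.
pose r := Num.min 1 (dl / (2 * (L + 1))).
have r0 : 0 < r by rewrite lt_min ltr01 divr_gt0 //; lra.
have r1 : r <= 1 by rewrite ge_min lexx.
have rdl : 2 * (L * r) <= dl.
  have : r <= dl / (2 * (L + 1)) by rewrite ge_min lexx orbT.
  by rewrite ler_pdivlMr; [nra|lra].
(* The jump [f v - f u] may leave the window, so only its fraction [kap] is used: as [f] oscillates
   by at most [L], this fraction is at most [dl / 2]. *)
pose kap := Num.min 1 (dl / (2 * (L + 1))).
have kap0 : 0 < kap by rewrite lt_min ltr01 divr_gt0 //; lra.
exists (c0 * kap * (r / 2)); first by rewrite !mulr_gt0 ?invr_gt0.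
exists (Num.truncn (2 / r)).+1 => n th u v Nn uv.
have rn : 2 <= r * n%:R.
  rewrite mulrC -ler_pdivrMr //; apply/ltW/(lt_le_trans (truncnS_gt _)).
  by rewrite ler_nat.
rewrite -sumrB.
pose G x := Psi (f v - f x) - Psi (f u - f x).
have := @sum_grid_ge R G n th u r (c0 * (kap * (f v - f u))).
have -> : c0 * kap * (r / 2) * (f v - f u) * n%:R =
  c0 * (kap * (f v - f u)) * (r / 2) * n%:R by ring.
apply => //.
- by move=> x; rewrite /G per.
- by move=> x; rewrite subr_ge0 mono // lerD2r.
- move=> x /andP[x1 x2]; rewrite /G.
  have xu : `|x - u| <= r by rewrite ler_norml; apply/andP; split; lra.
  have h1 : `|f x - f u| <= dl / 2.
    by apply: le_trans (lip _ _) _; have := ler_wpM2l L0 xu; lra.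
  move: h1; rewrite ler_norml => /andP[h1 h1'].
  have D1 : kap * (f v - f u) <= f v - f u.
    by rewrite ler_piMl ?subr_ge0 // ge_min lexx.
  have D0 : 0 <= kap * (f v - f u) by rewrite mulr_ge0 ?subr_ge0 // ltW.
  have D2 : kap * (f v - f u) <= dl / 2.
    have : kap <= dl / (2 * (L + 1)) by rewrite ge_min lexx orbT.
    rewrite ler_pdivlMr; last lra.
    by have := oscillation_le u v; nra.
  set D := kap * _ in D0 D1 D2 *.
  have : Psi (f u + D - f x) <= Psi (f v - f x) by apply: mono; lra.
  have : c0 * ((f u + D - f x) - (f u - f x)) <= Psi (f u + D - f x) - Psi (f u - f x).
    by apply: strong; lra.
  by rewrite (_ : f u + D - f x - (f u - f x) = D); [lra|ring].
- by rewrite mulr_ge0 ?mulr_ge0 ?subr_ge0 // ltW.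
Qed.

End PeriodicLipschitz.

(** * A lower bound for the noise density *)

Section DensityBoundedBelow.
Import HBNNSimple.

(* [phi] is not assumed measurable, so its integral is only the supremum of the
   integrals of the simple functions below it. *)
Lemma density_bounded_below (R : realType) (phi : R -> R)
    (m : {measure set R -> \bar R}) :
  (0 < m setT)%E ->
  (forall A, measurable A -> m A = (\int[lebesgue_measure]_(x in A) (phi x)%:E)%E) ->
  exists E : set R, exists eta : R, [/\ measurable E, 0 < eta,
    (0 < lebesgue_measure E)%E &
    forall A, measurable A -> (eta%:E * lebesgue_measure (A `&` E) <= m A)%E].
Proof.
move=> m0 mphi.
have : (0 < \int[lebesgue_measure]_x ((EFin \o phi)^\+ x))%E.
  apply: (lt_le_trans m0); rewrite mphi // integralE.
  by rewrite geeDl // leeNl oppe0 integral_ge0.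
rewrite ge0_integralTE //.
move=> /ereal_sup_gt[_ [h hphi <-] h0].
(* If every positive level of [h] were null, its integral would vanish. *)
have [v v0 hv] : exists2 v, 0 < v & (0 < lebesgue_measure (h @^-1` [set v]))%E.
  apply: contrapT => /forall2NP H; move: h0; rewrite /sintegral fsbig1 ?ltxx //.
  move=> x _; case: (ltP 0 x) => [x0|x0].
    case: (H x) => // /negP; rewrite -leNgt measure_le0 => /eqP ->.
    by rewrite mule0.
  have [->|xn0] := eqVneq x 0; first by rewrite mul0e.
  rewrite (_ : _ @^-1` _ = set0) ?measure0 ?mule0 // -subset0 => y /= hy.
  have : 0 <= h y by apply: fun_ge0.
  by rewrite hy => x0'; move: xn0; rewrite eq_le x0 x0'.
have mE : measurable (h @^-1` [set v]) by apply: measurable_sfunP.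
exists (h @^-1` [set v]), v; split => // A mA.
have mAE : measurable (A `&` h @^-1` [set v]) by apply: measurableI.
apply: (@le_trans _ _ (m (A `&` h @^-1` [set v]))); last first.
  by apply: le_measure; rewrite ?inE //; exact: subIsetl.
rewrite mphi // -integral_cst //.
have phiv x : (A `&` h @^-1` [set v]) x -> v <= phi x.
  move=> [_ /= hx]; have := hphi x; rewrite hx funeposE /=.
  by rewrite le_max => /orP[]; rewrite lee_fin // leNgt v0.
rewrite !ge0_integralE; last 2 first.
- by move=> x /phiv; rewrite lee_fin; apply: le_trans; exact: ltW.
- by move=> x _; rewrite lee_fin ltW.
apply: ereal_sup_le => _ [g gle <-]; exists g => // x.
apply: le_trans (gle x) _; rewrite /patch; case: ifPn => //.
by rewrite inE => /phiv; rewrite lee_fin.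
Qed.

End DensityBoundedBelow.

(** At a Lebesgue density point of [E] the relative measure of [E] in small balls tends to [1]. *)
Lemma exists_dense_ball (R : realType) (E : set R) :
  measurable E -> (0 < lebesgue_measure E)%E ->
  exists x r : R, 0 < r /\
    ((9 / 10 * (2 * r))%:E <= lebesgue_measure (E `&` ball x r))%E.
Proof.
move=> mE E0.
have := lebesgue_density mE => -[N [mN N0 EN]].
have [x Ex] : exists x, (E `\` N) x.
  apply/set0P/eqP => EN0; move: E0; rewrite lt_neqAle => /andP[/eqP + _]; apply.
  apply/esym; apply: (@subset_measure0 _ _ _ _ _ N) => //.
  by rewrite -setD_eq0.
exists x; have {EN} := contra_not (EN x) Ex.2 => /contrapT /= cv.
move: cv; rewrite indicE mem_set /=; last exact: Ex.1.
move=> cv.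
have H : \forall r \near (0 : R)^'+, 9 / 10 <
    fine (lebesgue_measure (E `&` ball x r) * (lebesgue_measure (ball x r))^-1)%E.
  apply: (cvgr_gt 1); first exact: (fine_cvg cv).
  by lra.
have : \forall r \near (0 : R)^'+, 0 < r /\ 9 / 10 <
    fine (lebesgue_measure (E `&` ball x r) * (lebesgue_measure (ball x r))^-1)%E.
  near=> r; split; first by near: r; exact: nbhs_right_gt.
  by near: r.
move=> /filter_ex [r [r0 hr]]; exists r; split => //.
have mB : measurable (ball x r : set R) by rewrite ball_itv.
have fm : lebesgue_measure (E `&` ball x r) \is a fin_num.
  rewrite ge0_fin_numE //; apply: (@le_lt_trans _ _ (lebesgue_measure (ball x r))).
    by apply: le_measure; rewrite ?inE //; exact: measurableI.
  by rewrite lebesgue_measure_ball ?ltry // ltW.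
move: hr; rewrite lebesgue_measure_ball; last exact: ltW.
rewrite -(fineK fm) inver mulrn_eq0 /= gt_eqF //.
rewrite -EFinM lee_fin /= => /ltW; rewrite ler_pdivlMr ?mulrn_wgt0 //.
by rewrite (mulr_natl r 2).
Unshelve. all: by end_near. Qed.

(* [G] is the distribution function of Lebesgue measure on the part of a set
   [E], on which the density is at least [eta], inside a ball where [E] has
   relative measure at least [9/10]. *)
Lemma cumulative_minorant (R : realType) (phi : R -> R)
    (m : {measure set R -> \bar R}) :
  (0 < m setT)%E ->
  (forall A, measurable A -> m A = (\int[lebesgue_measure]_(x in A) (phi x)%:E)%E) ->
  exists (G : R -> R) (eta y l : R), [/\ 0 < eta, 0 < l,
    forall s t, s <= t -> 0 <= G t - G s <= t - s,
    forall s t, s <= t -> ((eta * (G t - G s))%:E <= m `]s, t]%classic)%E &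
    9 / 10 * l <= G (y + l) - G y].
Proof.
move=> m0 mphi.
have [E [eta [mE eta0 E0 Em]]] := density_bounded_below m0 mphi.
have [x [r [r0 xr]]] := exists_dense_ball mE E0.
have mB : measurable (ball x r : set R) by rewrite ball_itv.
pose F := E `&` ball x r; have mF : measurable F by apply: measurableI.
have finF A : measurable A -> lebesgue_measure (F `&` A) \is a fin_num.
  move=> mA; rewrite ge0_fin_numE //; apply: (@le_lt_trans _ _ (lebesgue_measure (ball x r))).
    apply: le_measure; rewrite ?inE //; first exact: measurableI.
    by move=> z [[_ ?] _].
  by rewrite lebesgue_measure_ball ?ltry // ltW.
pose G t := fine (lebesgue_measure (F `&` `]-oo, t]%classic)).
have GE s t : s <= t -> ((G t - G s)%:E = lebesgue_measure (F `&` `]s, t]%classic)).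
  move=> st; rewrite EFinB /G !fineK ?finF //.
  rewrite (_ : F `&` `]-oo, t] = (F `&` `]-oo, s]) `|` (F `&` `]s, t])); last first.
    rewrite -setIUr; congr (_ `&` _); apply/seteqP; split => z /=; rewrite !in_itv /=.
      by move=> zt; have [zs|zs] := leP z s; [left|right].
    by move=> [zs|/andP[]//]; apply: le_trans st.
  rewrite measureU //; try exact: measurableI.
    by rewrite addeAC subee ?add0e // finF.
  apply/seteqP; split => z //= [[_ +] [_ +]]; rewrite !in_itv /= => zs /andP[sz _].
  by move: zs; rewrite leNgt sz.
have mst s t : measurable (F `&` `]s, t]%classic) by apply: measurableI.
exists G, eta, (x - r), (2 * r); split => //; first exact: mulr_gt0.
- move=> s t st; rewrite -!lee_fin (GE _ _ st) measure_ge0 /=.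
  apply: (@le_trans _ _ (lebesgue_measure (`]s, t]%classic : set R))).
    by apply: le_measure; rewrite ?inE //; exact: mst.
  rewrite lebesgue_measure_itv /= lte_fin; case: ifPn => // _.
  by rewrite lee_fin subr_ge0.
- move=> s t st; rewrite EFinM (GE _ _ st).
  apply: le_trans (Em _ (measurable_itv _)).
  rewrite lee_pmul2l // ?lte_fin //; apply: le_measure; rewrite ?inE //.
  - exact: mst.
  - exact: measurableI.
  - by move=> z [[? _] ?].
- rewrite -lee_fin GE; last by rewrite lerDl; lra.
  apply: (le_trans xr); apply: le_measure; rewrite ?inE //.
  - exact: mst.
  move=> z [Ez]; rewrite ball_itv /= in_itv /= => /andP[z1 z2]; split.
    by split=> //; rewrite ball_itv /= in_itv /= z1.
  by rewrite /= in_itv /=; apply/andP; split; lra.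
Qed.

(* The pairs of cells [`]s k, s k.+1]], [`]s k + a + u, s k.+1 + a + u]] are
   disjoint rectangles inside the strip [a < z' - z <= b]. On each one
   [(u - x) * (u - x') >= u * (u - x - x')], where [x], [x'] are the masses
   missing from the two cells. *)
Lemma strip_cells (R : realType) (G : R -> R) (y l a b : R) :
  0 < l -> (forall s t, s <= t -> 0 <= G t - G s <= t - s) ->
  9 / 10 * l <= G (y + l) - G y ->
  - (l / 10) <= a -> a < b -> b <= l / 10 ->
  exists (q : nat) (u : R), [/\ 0 < u, 2 * u <= b - a &
    l / 10 * (b - a) <= \sum_(k < q) (G (y + k.+1%:R * u) - G (y + k%:R * u)) *
      (G (y + k.+1%:R * u + (a + u)) - G (y + k%:R * u + (a + u)))].
Proof.
move=> l0 G1 Gl al ab bl.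
(* The mesh satisfies [2 * u <= b - a <= 4 * u]: the left bound fits each rectangle into the strip,
   the right one keeps [u] comparable to its width. *)
pose q := (Num.truncn (2 * l / (b - a))).+1; pose u := l / q%:R.
have ba : 0 < b - a by rewrite subr_gt0.
have q0 : 0 < q%:R :> R by rewrite ltr0n.
have ql : 2 * l < q%:R * (b - a) by rewrite -ltr_pdivrMr // truncnS_gt.
have qle : q%:R * (b - a) <= 4 * l.
  have : (Num.truncn (2 * l / (b - a)))%:R <= 2 * l / (b - a).
    by rewrite truncn_le // divr_ge0 ?mulr_ge0 // ltW.
  by rewrite ler_pdivlMr // /q -natr1; lra.
have u0 : 0 < u by rewrite divr_gt0.
have qu : q%:R * u = l by rewrite /u mulrC divfK // gt_eqF.
have u2 : 2 * u <= b - a by rewrite -(ler_pM2l q0); lra.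
have u4 : b - a <= 4 * u by rewrite -(ler_pM2l q0); lra.
exists q, u; split => //.
pose s (k : nat) := y + k%:R * u; pose c := a + u.
have tel (h : R) : \sum_(k < q) (G (s k.+1 + h) - G (s k + h)) = G (y + l + h) - G (y + h).
  rewrite -(big_mkord xpredT (fun k => G (s k.+1 + h) - G (s k + h))).
  by rewrite telescope_sumr // /s qu mul0r addr0.
(* A translation by at most [l / 10] loses mass at one end only. *)
have Gc : 8 / 10 * l <= G (y + l + c) - G (y + c).
  case: (leP 0 c) => c0.
    have := G1 (y + l) (y + l + c); have := G1 y (y + c).
    rewrite /c in c0 *; move=> h1 h2.
    move: (h1 ltac:(lra)) (h2 ltac:(lra)) => /andP[? ?] /andP[? ?].
    by lra.
  have := G1 (y + l + c) (y + l); have := G1 (y + c) y.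
  rewrite /c in c0 *; move=> h1 h2; move: (h1 ltac:(lra)) (h2 ltac:(lra)) => /andP[? ?] /andP[? ?].
  by lra.
have cell (k : 'I_q) : u * ((G (s k.+1 + 0) - G (s k + 0)) + (G (s k.+1 + c) - G (s k + c)) - u)
    <= (G (s k.+1) - G (s k)) * (G (s k.+1 + c) - G (s k + c)).
  rewrite !addr0.
  have su : s k.+1 = s k + u by rewrite /s -natr1; ring.
  have := G1 (s k) (s k.+1); have := G1 (s k + c) (s k.+1 + c).
  rewrite su => h1 h2; move: (h1 ltac:(lra)) (h2 ltac:(lra)).
  set X := G _ - G _; set Y := G _ - G _ => /andP[_ X1] /andP[_ Y1].
  have : 0 <= (u - X) * (u - Y) by rewrite mulr_ge0 //; lra.
  by lra.
apply: le_trans (ler_sum _ (fun k _ => cell k)).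
rewrite -mulr_sumr sumrB big_split /= !tel !addr0 sumr_const card_ord -[u *+ q]mulr_natl qu.
(* The two families of cells miss at most [l / 10] and [2 * l / 10]. *)
have h : 7 / 10 * l <= G (y + l) - G y + (G (y + l + c) - G (y + c)) - l by lra.
have := ler_wpM2l (ltW u0) h.
have := ler_wpM2l (ltW l0) u4.
have := mulr_ge0 (ltW u0) (ltW l0).
by lra.
Qed.

(** * Independence of pairs *)

Section Independence.
Local Open Scope ereal_scope.
Context {d} {T : measurableType d} {R : realType} (P : probability T R).

(** Rectangles determine a finite measure on the plane, so the factorization extends to every [C].
    The full space as [E] yields the joint law, an event about other variables yields
    independence. *)
Lemma joint_law_independent_of (X Y : {RV P >-> R}) (mu nu : probability R R)
    (E : set T) :
  measurable E ->
  (forall A B, measurable A -> measurable B ->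
     P (X @^-1` A `&` Y @^-1` B `&` E) = mu A * nu B * P E) ->
  forall C : set (R * R), measurable C ->
    P ((fun w => (X w, Y w)) @^-1` C `&` E) = (mu \x nu) C * P E.
Proof.
move=> mE rect C mC.
have mXY : measurable_fun [set: T] (fun w => (X w, Y w)).
  exact: measurable_fun_pair.
have p0 : (0 <= fine (P E))%R by rewrite fine_ge0.
have PE : (fine (P E))%:E = P E by rewrite fineK // fin_num_measure.
pose r := NngNum p0; have rE : r%:num%:E = P E by rewrite -PE.
pose m1 : {measure set (R * R) -> \bar R} :=
  measure_function_pushforward__canonical__measure_function_Measure (mrestr P mE) mXY.
pose m2 : {measure set (R * R) -> \bar R} := mscale r (mu \x nu).
have h1 : (mscale r mu \x nu) C = m1 C.
  apply: product_measure_unique => // A B mA mB.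
  transitivity (mu A * nu B * P E); first exact: rect.
  by rewrite /= /mscale -/r rE -[RHS]muleA muleC.
have h2 : (mscale r mu \x nu) C = m2 C.
  apply: product_measure_unique => // A B mA mB.
  by rewrite /m2 /= /mscale /= product_measure1E //= muleA.
transitivity (m1 C) => //.
by rewrite -h1 h2 /m2 /= /mscale rE muleC.
Qed.

Variable Z : nat -> {RV P >-> R}.
Hypothesis indep : mutually_independent P Z.

Lemma independent4 (i j k l : nat) (A B C D : set R) : uniq [:: i; j; k; l] ->
  measurable A -> measurable B -> measurable C -> measurable D ->
  P (Z i @^-1` A `&` Z j @^-1` B `&` (Z k @^-1` C `&` Z l @^-1` D)) =
  P (Z i @^-1` A) * P (Z j @^-1` B) * (P (Z k @^-1` C) * P (Z l @^-1` D)).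
Proof.
move=> u mA mB mC mD.
pose F m := if m == i then A else if m == j then B else if m == k then C else D.
have mF m : measurable (F m) by rewrite /F; do 3 case: ifP => // _.
have := indep u mF; rewrite bigcap_seq !big_cons !big_nil setIT mule1.
move: u; rewrite /= !inE !negb_or => /and4P[/and3P[ij ik il] /andP[jk jl] kl _].
rewrite /F eqxx (eq_sym j) (negbTE ij) eqxx (eq_sym k i) (eq_sym k j) (negbTE ik) (negbTE jk) eqxx.
by rewrite (eq_sym l i) (eq_sym l j) (eq_sym l k) (negbTE il) (negbTE jl) (negbTE kl) setIA !muleA.
Qed.

Lemma independent2 (i j : nat) (A B : set R) : i != j ->
  measurable A -> measurable B ->
  P (Z i @^-1` A `&` Z j @^-1` B) = P (Z i @^-1` A) * P (Z j @^-1` B).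
Proof.
move=> ij mA mB.
have [k [ik jk]] : exists k, i != k /\ j != k.
  by exists (i + j).+1; split; lia.
have [l [il jl kl]] : exists l, [/\ i != l, j != l & k != l].
  by exists (i + j + k).+1; split; lia.
have := @independent4 i j k l A B setT setT.
rewrite !preimage_setT !setIT probability_setT !mule1; apply => //.
by rewrite /= !inE !negb_or ij ik il jk jl kl.
Qed.

Variable phi : R -> R.
Hypothesis dens : forall i, has_density P (Z i) phi.

Let mu : probability R R := distribution P (Z 0%N).

Lemma same_law i A : measurable A -> P (Z i @^-1` A) = mu A.
Proof. by move=> mA; rewrite (dens i mA); exact/esym/(dens 0%N mA). Qed.

Lemma pair_law i j (C : set (R * R)) : i != j -> measurable C ->
  P ((fun w => (Z i w, Z j w)) @^-1` C) = (mu \x mu) C.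
Proof.
move=> ij mC; rewrite -[X in P X]setIT -[RHS]mule1 -(@probability_setT _ _ _ P).
apply: joint_law_independent_of => //.
move=> A B mA mB; rewrite setIT probability_setT mule1 independent2 //.
by rewrite !same_law.
Qed.

(** Rectangles are replaced by arbitrary sets one pair at a time: first for [C] with the event of
    [D] kept fixed, then for [D] with a rectangle in place of [C]. *)
Lemma pair_independent i j k l (C D : set (R * R)) : uniq [:: i; j; k; l] ->
  measurable C -> measurable D ->
  P ((fun w => (Z i w, Z j w)) @^-1` C `&` (fun w => (Z k w, Z l w)) @^-1` D) =
  P ((fun w => (Z i w, Z j w)) @^-1` C) * P ((fun w => (Z k w, Z l w)) @^-1` D).
Proof.
move=> u mC mD.
have u2 : uniq [:: k; l; i; j] by rewrite -(rot_uniq 2%N).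
have ij : i != j.
  by move: u; rewrite /= !inE !negb_or => /and4P[/and3P[]].
have kl : k != l.
  by move: u2; rewrite /= !inE !negb_or => /and4P[/and3P[]].
have mE m m' (F : set (R * R)) : measurable F ->
    measurable ((fun w => (Z m w, Z m' w)) @^-1` F).
  move=> mF; rewrite -[X in measurable X]setTI.
  by apply: (measurable_fun_pair _ _ measurableT) => //.
rewrite [in RHS]pair_law //.
apply: joint_law_independent_of => //; first exact: mE.
move=> A B mA mB.
rewrite setIC [in RHS]pair_law // [in RHS]muleC.
have mI : measurable (Z i @^-1` A `&` Z j @^-1` B).
  by apply: measurableI; rewrite -[X in measurable X]setTI; apply: measurable_funPT.
rewrite -(same_law i mA) -(same_law j mB) -independent2 //.
apply: joint_law_independent_of => // A' B' mA' mB'.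
rewrite setIC independent4 // independent2 // !(same_law k) // !(same_law l) //.
by rewrite muleC.
Qed.

End Independence.

(** * The distribution function of noise differences *)

Section NoiseDifference.
Context {d} {T : measurableType d} {R : realType} (P : probability T R).
Variables (Z : nat -> {RV P >-> R}) (phi : R -> R).
Hypothesis indep : mutually_independent P Z.
Hypothesis dens : forall i, has_density P (Z i) phi.

Definition below_diagonal (t : R) : set (R * R) := [set p | p.2 - p.1 <= t].

Lemma measurable_below_diagonal t : measurable (below_diagonal t).
Proof.
rewrite (_ : below_diagonal t = [set: R * R] `&`
    (fun p : R * R => p.2 - p.1) @^-1` `]-oo, t]); last first.
  by apply/seteqP; split => p /=; rewrite in_itv //=; tauto.
suff mf : measurable_fun setT (fun p : R * R => p.2 - p.1) by exact: mf.
by apply: measurable_funB; [exact: measurable_snd|exact: measurable_fst].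
Qed.

(** With [t] the difference of the signals at [i] and [j], this is the event that observation [j]
    does not exceed observation [i]. *)
Definition diff_le i j t : set T := (fun w => (Z i w, Z j w)) @^-1` below_diagonal t.

(* The paper's [Phi_2]. *)
Definition diff_cdf (t : R) : R := fine (P (diff_le 0 1 t)).

Lemma measurable_diff_le i j t : measurable (diff_le i j t).
Proof.
rewrite -[X in measurable X]setTI.
by apply: (measurable_fun_pair _ _ measurableT) => //; exact: measurable_below_diagonal.
Qed.

Lemma prob_diff_le i j t : i != j -> P (diff_le i j t) = (diff_cdf t)%:E.
Proof.
move=> ij; rewrite /diff_cdf fineK ?fin_num_measure //; last exact: measurable_diff_le.
by rewrite /diff_le !(pair_law indep dens) //; exact: measurable_below_diagonal.
Qed.

Lemma diff_cdf_mono a b : a <= b -> diff_cdf a <= diff_cdf b.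
Proof.
move=> ab; rewrite -lee_fin -!(@prob_diff_le 0 1) //.
apply: le_measure; rewrite ?inE; try exact: measurable_diff_le.
by move=> w /=; rewrite /diff_le /below_diagonal /=; move/le_trans; apply.
Qed.

(** The increment is the probability of the strip [a < z' - z <= b], which contains the disjoint
    rectangles of [strip_cells]; by independence each has at least [eta ^ 2] times the product of
    the [G]-increments of its sides. *)
Lemma diff_cdf_strong : exists c dl : R, [/\ 0 < c, 0 < dl &
  forall a b, - dl <= a -> a <= b -> b <= dl -> c * (b - a) <= diff_cdf b - diff_cdf a].
Proof.
have m0 : (0 < distribution P (Z 0%N) setT)%E by rewrite probability_setT.
have [G [eta [y [l [eta0 l0 G1 Geta Gl]]]]] := cumulative_minorant m0 (dens 0%N).
exists (eta ^+ 2 * (l / 10)), (l / 10); split; rewrite ?mulr_gt0 ?exprn_gt0 ?invr_gt0 //.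
move=> a b al; rewrite le_eqVlt => /orP[/eqP <- _|ab bl]; first by rewrite !subrr mulr0.
have [q [u [u0 u2 H]]] := strip_cells l0 G1 Gl al ab bl.
pose s (k : nat) := y + k%:R * u.
have sS k : s k.+1 = s k + u by rewrite /s -natr1; ring.
pose F (k : 'I_q) : set T := Z 0%N @^-1` `]s k, s k.+1] `&`
  Z 1%N @^-1` `]s k + (a + u), s k.+1 + (a + u)].
have mI n (x x' : R) : measurable (Z n @^-1` `]x, x']).
  by rewrite -[X in measurable X]setTI; apply: measurable_funPT.
have mF k : measurable (F k) by apply: measurableI.
have tF : trivIset setT F.
  have sep (i j : 'I_q) w : F i w -> F j w -> (i < j)%N -> False.
    move=> [/= + _] [/= + _]; rewrite !in_itv /= => /andP[_ h1] /andP[h2 _] ij.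
    have : s i.+1 <= s j by rewrite /s lerD2l ler_wpM2r ?ler_nat // ltW.
    by move: h1 h2; lra.
  move=> i j _ _ [w [Fi Fj]]; apply/val_inj.
  by case: (ltngtP i j) => // ij; [case: (sep _ _ _ Fi Fj ij)|case: (sep _ _ _ Fj Fi ij)].
have FD k : F k `<=` diff_le 0 1 b `\` diff_le 0 1 a.
  move=> w [/=]; rewrite !in_itv /= => /andP[h1 h2] /andP[h3 h4].
  rewrite /diff_le /below_diagonal /=; move: h1 h2 h3 h4; rewrite sS => h1 h2 h3 h4.
  by split; [lra|apply/negP; rewrite -ltNge; lra].
have PD : (P (diff_le 0 1 b `\` diff_le 0 1 a) <= (diff_cdf b - diff_cdf a)%:E)%E.
  rewrite EFinB -!(@prob_diff_le 0 1) //.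
  rewrite measureD; try exact: measurable_diff_le.
    rewrite (_ : diff_le 0 1 b `&` diff_le 0 1 a = diff_le 0 1 a) //.
    apply: setIidr => w /=; rewrite /diff_le /below_diagonal /=.
    by move/le_trans; apply; exact: ltW.
  by rewrite -ge0_fin_numE // fin_num_measure //; exact: measurable_diff_le.
rewrite -lee_fin; apply: le_trans PD.
apply: (@le_trans _ _ (P (\big[setU/set0]_(k < q) F k))); last first.
  apply: le_measure; rewrite ?inE.
  - by apply: bigsetU_measurable.
  - by apply: measurableD; exact: measurable_diff_le.
  - apply: (big_ind (fun S => S `<=` _)) => [//|A B AD BD|k _]; last exact: FD.
    by rewrite subUset.
rewrite measure_bigsetU_ord //.
apply: (@le_trans _ _ (\sum_(k < q) (eta ^+ 2 * ((G (s k.+1) - G (s k)) *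
   (G (s k.+1 + (a + u)) - G (s k + (a + u))))))%:E).
  rewrite lee_fin -mulr_sumr -mulrA ler_wpM2l ?sqr_ge0 //.
rewrite -sumEFin; apply: lee_sum => k _.
have PF : (distribution P (Z 0%N) (`]s k, s k.+1] : set R) *
    distribution P (Z 0%N) (`](s k + (a + u))%R, (s k.+1 + (a + u))%R] : set R) <=
    P (F k))%E.
  by rewrite /F (independent2 indep) // !(same_law dens).
apply: le_trans PF.
have h1 := Geta (s k) (s k.+1) ltac:(rewrite sS; lra).
have h2 := Geta (s k + (a + u)) (s k.+1 + (a + u)) ltac:(rewrite sS; lra).
have /andP[g1 _] := G1 (s k) (s k.+1) ltac:(rewrite sS; lra).
have /andP[g2 _] := G1 (s k + (a + u)) (s k.+1 + (a + u)) ltac:(rewrite sS; lra).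
apply: le_trans (lee_pmul _ _ h1 h2); rewrite ?lee_fin ?mulr_ge0 ?(ltW eta0) //.
by lra.
Qed.

End NoiseDifference.

(** * Second moment of rank fluctuations *)

Section BoundedExpectation.
Context {d} {T : measurableType d} {R : realType} (P : probability T R).
Implicit Types X Y : T -> R.

Definition bounded_measurable X :=
  measurable_fun [set: T] X /\ exists M, forall w, `|X w| <= M.

Definition mean X : R := Rintegral P setT X.

Lemma bounded_integrable X : bounded_measurable X -> P.-integrable setT (EFin \o X).
Proof.
move=> [mX [M bX]]; apply: measurable_bounded_integrable => //.
  by apply: (le_lt_trans (@probability_le1 _ _ _ P _ measurableT)); rewrite ltry.
exists M; split; first exact: num_real.
by move=> y My w _; apply: le_trans (bX w) (ltW My).
Qed.

Lemma bounded_measurable_cst (c : R) : bounded_measurable (fun=> c).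
Proof. by split; [exact: measurable_cst|exists `|c|]. Qed.

Lemma bounded_measurableD X Y : bounded_measurable X -> bounded_measurable Y ->
  bounded_measurable (fun w => X w + Y w).
Proof.
move=> [mX [M bX]] [mY [M' bY]]; split; first exact: measurable_funD.
by exists (M + M') => w; apply: le_trans (ler_normD _ _) (lerD (bX w) (bY w)).
Qed.

Lemma bounded_measurableM X Y : bounded_measurable X -> bounded_measurable Y ->
  bounded_measurable (fun w => X w * Y w).
Proof.
move=> [mX [M bX]] [mY [M' bY]]; split; first exact: measurable_funM.
by exists (M * M') => w; rewrite normrM ler_pM.
Qed.

Lemma bounded_measurable_sum (I : Type) (r : seq I) (F : I -> T -> R) :
  (forall i, bounded_measurable (F i)) ->
  bounded_measurable (fun w => \sum_(i <- r) F i w).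
Proof.
move=> bF; elim: r => [|i r IHr].
  by under eq_fun do rewrite big_nil; exact: bounded_measurable_cst.
by under eq_fun do rewrite big_cons; exact: bounded_measurableD.
Qed.

Lemma bounded_measurable_indic (A : set T) : measurable A ->
  bounded_measurable (\1_A : T -> R).
Proof.
move=> mA; split; first exact: measurable_indic.
by exists 1 => w; rewrite indicE; case: (_ \in _); rewrite ?normr1 ?normr0.
Qed.

Lemma mean_cst c : mean (fun=> c) = c.
Proof.
rewrite /mean Rintegral_cst // (_ : fine _ = 1) ?mulr1 //.
exact: (congr1 fine (@probability_setT _ _ _ P)).
Qed.

Lemma meanD X Y : bounded_measurable X -> bounded_measurable Y ->
  mean (fun w => X w + Y w) = mean X + mean Y.
Proof. by move=> bX bY; apply: RintegralD => //; exact: bounded_integrable. Qed.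

Lemma meanZ c X : bounded_measurable X -> mean (fun w => c * X w) = c * mean X.
Proof. by move=> bX; apply: RintegralZl => //; exact: bounded_integrable. Qed.

Lemma mean_sum (I : Type) (r : seq I) (F : I -> T -> R) :
  (forall i, bounded_measurable (F i)) ->
  mean (fun w => \sum_(i <- r) F i w) = \sum_(i <- r) mean (F i).
Proof.
move=> bF; elim: r => [|i r IHr].
  by under eq_fun do rewrite big_nil; rewrite mean_cst big_nil.
under eq_fun do rewrite big_cons.
by rewrite meanD ?IHr ?big_cons //; exact: bounded_measurable_sum.
Qed.

Lemma mean_indic (A : set T) : measurable A -> mean (\1_A : T -> R) = fine (P A).
Proof. by move=> mA; rewrite /mean /Rintegral integral_indic // setIT. Qed.

Lemma mean_le X Y : bounded_measurable X -> bounded_measurable Y ->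
  (forall w, X w <= Y w) -> mean X <= mean Y.
Proof. by move=> bX bY XY; apply: le_Rintegral => //; exact: bounded_integrable. Qed.

Lemma measurable_superlevel X tau : bounded_measurable X ->
  measurable [set w | tau <= X w].
Proof.
move=> [mX _]; rewrite (_ : [set w | _] = [set: T] `&` X @^-1` `[tau, +oo[).
  by apply: mX.
by apply/seteqP; split => w /=; rewrite in_itv /= andbT; tauto.
Qed.

Lemma mean_markov X tau : bounded_measurable X -> (forall w, 0 <= X w) ->
  tau * fine (P [set w | tau <= X w]) <= mean X.
Proof.
move=> bX X0; have mA := measurable_superlevel tau bX.
have bI := bounded_measurable_indic mA.
rewrite -mean_indic // -meanZ //; apply: mean_le => //.
  by apply: bounded_measurableM => //; exact: bounded_measurable_cst.
move=> w; rewrite indicE; case: (boolP (w \in _)) => [|_]; last by rewrite mulr0.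
by rewrite inE /= mulr1.
Qed.

Let prob (A : set T) : R := fine (P A).

Let prob_itv (A : set T) : measurable A -> 0 <= prob A <= 1.
Proof.
move=> mA; rewrite fine_ge0 //= -lee_fin fineK ?fin_num_measure //.
exact: probability_le1.
Qed.

Lemma mean_centered_product (A B : set T) (p q : R) : measurable A -> measurable B ->
  p = prob A -> q = prob B ->
  mean (fun w => (\1_A w - p) * (\1_B w - q)) = prob (A `&` B) - p * q.
Proof.
move=> mA mB pE qE.
have bA := bounded_measurable_indic mA; have bB := bounded_measurable_indic mB.
have mAB := measurableI _ _ mA mB; have bAB := bounded_measurable_indic mAB.
have bc c := bounded_measurable_cst c.
rewrite (_ : (fun w => _) = (fun w => \1_(A `&` B) w +
   ((- q) * \1_A w + ((- p) * \1_B w + p * q)))); last first.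
  by apply/funext => w; rewrite indicI /=; ring.
have b1 := bounded_measurableM (bc (- q)) bA.
have b2 := bounded_measurableM (bc (- p)) bB.
have b3 := bounded_measurableD b2 (bc (p * q)).
have b4 := bounded_measurableD b1 b3.
rewrite !meanD // !meanZ // !mean_indic // mean_cst -!/(prob _) -pE -qE; ring.
Qed.

Lemma second_moment_indics (I : finType) (A : I -> set T) (a : I -> R) :
  (forall i, measurable (A i)) ->
  mean (fun w => (\sum_i a i * (\1_(A i) w - prob (A i))) ^+ 2) =
  \sum_i \sum_j a i * a j * (prob (A i `&` A j) - prob (A i) * prob (A j)).
Proof.
move=> mA.
have bc c := bounded_measurable_cst c.
have bX i : bounded_measurable (fun w => \1_(A i) w - prob (A i)).
  by apply: bounded_measurableD (bc _); exact: bounded_measurable_indic.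
have bXX i j := bounded_measurableM (bX i) (bX j).
have bF i j := bounded_measurableM (bc (a i * a j)) (bXX i j).
rewrite (_ : (fun w => _) = (fun w => \sum_i \sum_j a i * a j *
    ((\1_(A i) w - prob (A i)) * (\1_(A j) w - prob (A j))))); last first.
  apply/funext => w; rewrite expr2 mulr_suml; apply: eq_bigr => i _.
  by rewrite mulr_sumr; apply: eq_bigr => j _; ring.
rewrite mean_sum; last by move=> i; apply: bounded_measurable_sum => j; exact: bF.
apply: eq_bigr => i _; rewrite mean_sum; last by move=> j; exact: bF.
by apply: eq_bigr => j _; rewrite meanZ // mean_centered_product.
Qed.

(** The second moment is a double sum of covariances of indicators. Those outside [r] vanish and the
    others are at most [1] in absolute value. *)
Lemma second_moment_sparse (I : finType) (A : I -> set T) (a : I -> R) (B : R)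
    (r : I -> I -> bool) :
  (forall i, measurable (A i)) -> (forall i, `|a i| <= B) ->
  (forall i j, ~~ r i j -> P (A i `&` A j) = (P (A i) * P (A j))%E) ->
  mean (fun w => (\sum_i a i * (\1_(A i) w - prob (A i))) ^+ 2) <=
  B ^+ 2 * \sum_i \sum_j (r i j)%:R.
Proof.
move=> mA aB ind; rewrite second_moment_indics // mulr_sumr; apply: ler_sum => i _.
rewrite mulr_sumr; apply: ler_sum => j _.
have [_|nr] := boolP (r i j); last first.
  rewrite /prob ind // fineM ?fin_num_measure // subrr !mulr0 //.
rewrite mulr1; apply: le_trans (ler_norm _) _.
have /andP[p0 p1] := prob_itv (mA i); have /andP[q0 q1] := prob_itv (mA j).
have /andP[s0 s1] := prob_itv (measurableI _ _ (mA i) (mA j)).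
rewrite -(mulr1 (B ^+ 2)) !normrM expr2 !ler_pM ?mulr_ge0 //.
have := mulr_ge0 p0 q0; have := ler_pM p0 q0 p1 q1; rewrite mulr1 => ? ?.
by rewrite ler_norml; apply/andP; split; lra.
Qed.

End BoundedExpectation.

(** The two counts are packed into a pair so as to form a single rewriting rule. *)
Lemma sum_pairs_eq (R : realDomainType) (n : nat) (x : 'I_n) :
  (\sum_(p : 'I_n * 'I_n) (x == p.1)%:R = n%:R :> R) *
  (\sum_(p : 'I_n * 'I_n) (x == p.2)%:R = n%:R :> R).
Proof.
have one : \sum_(k < n) (x == k)%:R = 1 :> R.
  rewrite (bigD1 x) //= eqxx big1 ?addr0 // => k kx.
  by rewrite eq_sym (negbTE kx).
split.
  rewrite -(pair_bigA _ (fun k _ => (x == k)%:R)) /=.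
  under eq_bigr do rewrite sumr_const card_ord.
  by rewrite sumrMnl one.
rewrite -(pair_bigA _ (fun _ l => (x == l)%:R)) /=.
under eq_bigr do rewrite one.
by rewrite sumr_const card_ord.
Qed.

Section RankFluctuation.
Context {d} {T : measurableType d} {R : realType} (P : probability T R).
Variables (Z : nat -> {RV P >-> R}) (phi : R -> R).
Hypothesis indep : mutually_independent P Z.
Hypothesis dens : forall i, has_density P (Z i) phi.

(* Only index pairs sharing an index are correlated, and there are at most
   [4 * n ^ 3] such couples of pairs. *)
Lemma rank_fluctuation_second_moment (n : nat) (y : 'I_n -> R) (b : 'I_n -> R) (B : R)
    (A : 'I_n * 'I_n -> set T) :
  (forall p, A p = diff_le Z p.1.+1 p.2.+1 (y p.1 - y p.2)) ->
  (forall i, `|b i| <= B) ->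
  mean P (fun w => (\sum_p b p.1 * (\1_(A p) w - fine (P (A p)))) ^+ 2) <=
  4 * n%:R ^+ 3 * B ^+ 2.
Proof.
move=> AE bB.
have mA p : measurable (A p) by rewrite AE; exact: measurable_diff_le.
pose r (p p' : 'I_n * 'I_n) :=
  [|| p.1 == p'.1, p.1 == p'.2, p.2 == p'.1 | p.2 == p'.2].
(* Diagonal pairs give the sure event, which is independent of everything. *)
have AT i : A (i, i) = setT.
  rewrite AE /= subrr; apply/seteqP; split => // w _.
  by rewrite /diff_le /below_diagonal /= subrr.
have h := @second_moment_sparse _ _ _ P _ A (fun p => b p.1) B r mA (fun p => bB p.1).
apply: (le_trans (h _)).
  move=> [i j] [k l]; rewrite /r /= !negb_or => /and4P[ik il jk jl].
  have [<-|ij] := eqVneq i j; first by rewrite AT setTI probability_setT mul1e.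
  have [<-|kl] := eqVneq k l; first by rewrite AT setIT probability_setT mule1.
  rewrite !AE /=; apply: (pair_independent indep dens); try exact: measurable_below_diagonal.
  by rewrite /= !inE !negb_or !eqSS ij ik il jk jl kl.
rewrite mulrC ler_wpM2r ?sqr_ge0 //.
apply: (@le_trans _ _ (\sum_(p : 'I_n * 'I_n) (4 * n%:R))).
  apply: ler_sum => p _.
  apply: (@le_trans _ _ (\sum_(p' : 'I_n * 'I_n) ((p.1 == p'.1)%:R + (p.1 == p'.2)%:R +
      ((p.2 == p'.1)%:R + (p.2 == p'.2)%:R)))).
    apply: ler_sum => p' _; rewrite /r.
    by case: eqP; case: eqP; case: eqP; case: eqP => /= *; lra.
  by rewrite !big_split /= !sum_pairs_eq; lra.
rewrite sumr_const card_prod !card_ord -[leLHS]mulr_natl natrM.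
by rewrite le_eqVlt; apply/orP; left; apply/eqP; ring.
Qed.

End RankFluctuation.

(** * The criterion and its drift *)

(** Comparison with a telescoping sum: [1 / x - 1 / (x + 1) = 1 / (x * (x + 1))] is at least
    [1 / (2 * x ^ 2)] for [x >= 1]. *)
Lemma sum_inv_sqr_le (R : realFieldType) (m : R) (q : nat) : 1 <= m ->
  \sum_(l < q) ((m + l%:R) ^+ 2)^-1 <= 2 / m.
Proof.
move=> m1; have m0 : 0 < m by lra.
suff H : \sum_(l < q) ((m + l%:R) ^+ 2)^-1 <= 2 * (m^-1 - (m + q%:R)^-1).
  apply: (le_trans H); have : 0 <= (m + q%:R)^-1 by rewrite invr_ge0 addr_ge0 // ltW.
  by lra.
elim: q => [|q IHq]; first by rewrite big_ord0 addr0 subrr mulr0.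
rewrite big_ord_recr /= -(natr1 q) addrA; set x := m + q%:R in IHq *.
have x1 : 1 <= x by rewrite -[1]addr0 lerD.
have x0 : 0 < x by lra.
have : (x ^+ 2)^-1 <= 2 * (x^-1 - (x + 1)^-1).
  have x2 : 0 < x + 1 by lra.
  have -> : 2 * (x^-1 - (x + 1)^-1) = 2 / (x * (x + 1)).
    by field; rewrite !gt_eqF.
  rewrite ler_pdivlMr ?mulr_gt0 // -ler_pdivlMl ?invr_gt0 ?exprn_gt0 // invrK.
  by nra.
by lra.
Qed.

(* AM-GM: [2 * V l <= lambda * V l ^ 2 / (m + l) ^ 2 + (m + l) ^ 2 / lambda] with
   [lambda = 4 * k / c]. *)
Lemma weighted_energy_ge (R : realFieldType) (V : nat -> R) (n k : nat) (m c : R) :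
  0 < c -> 0 < m -> m <= k%:R -> (k <= n)%N ->
  c * k%:R ^+ 2 <= \sum_(l < k) V l ->
  c ^+ 2 / 4 * k%:R <= \sum_(l < n) V l ^+ 2 / (m + l%:R) ^+ 2.
Proof.
move=> c0 m0 mk kn H.
have k0 : 0 < k%:R :> R by lra.
pose lam := 4 * k%:R / c.
have lam0 : 0 < lam by rewrite divr_gt0 // mulr_gt0.
have amgm (l : 'I_k) : V l <= lam / 2 * (V l ^+ 2 / (m + l%:R) ^+ 2) + 2 * k%:R ^+ 2 / lam.
  have lk : l%:R <= k%:R :> R by rewrite ler_nat ltnW.
  have x0 : 0 < m + l%:R by rewrite ltr_wpDr.
  have : (m + l%:R) ^+ 2 / lam / 2 <= 2 * k%:R ^+ 2 / lam.
    rewrite mulrAC ler_pM2r ?invr_gt0 //.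
    have : (m + l%:R) ^+ 2 <= (2 * k%:R) ^+ 2 by rewrite ler_sqr ?nnegrE; lra.
    by lra.
  set x := m + l%:R in x0 *.
  have : 0 <= (lam * V l / x - x) ^+ 2 / lam by rewrite divr_ge0 ?sqr_ge0 ?ltW.
  have -> : (lam * V l / x - x) ^+ 2 / lam =
      lam * (V l ^+ 2 / x ^+ 2) - 2 * V l + x ^+ 2 / lam.
    by field; rewrite !gt_eqF.
  by lra.
have {H} := le_trans H (ler_sum _ (fun l _ => amgm l)).
rewrite big_split /= -mulr_sumr sumr_const card_ord -[(_ / lam) *+ k]mulr_natl.
set q := \sum_(l < k) _; set Q := \sum_(l < n) _ => H.
have qQ : q <= Q.
  rewrite /q /Q (big_ord_widen n (fun l => V l ^+ 2 / (m + l%:R) ^+ 2) kn).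
  rewrite [leRHS](bigID (fun l : 'I_n => (l < k)%N)) /= lerDl.
  by apply: sumr_ge0 => l _; rewrite divr_ge0 ?sqr_ge0.
(* With this [lam] the error terms amount to half of the assumed lower bound. *)
have e1 : k%:R * (2 * k%:R ^+ 2 / lam) = c / 2 * k%:R ^+ 2.
  by rewrite /lam; field; rewrite !gt_eqF.
have : c / 2 * k%:R ^+ 2 <= lam / 2 * Q.
  have : lam / 2 * q <= lam / 2 * Q by rewrite ler_pM2l // divr_gt0.
  by rewrite e1 in H; lra.
have -> : lam / 2 * Q = 2 / c * Q * k%:R by rewrite /lam; field; rewrite gt_eqF.
rewrite expr2 mulrA ler_pM2r // => h.
have := ler_wpM2l (ltW c0) h.
have -> : c * (2 / c * Q) = 2 * Q by field; rewrite gt_eqF.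
by lra.
Qed.

(** The integer nearest to [a - b] is its floor or the floor plus one, as decided by the minimum.
    The minus sign matches [s] with the direction of the index shift in [grid_shift]. *)
Lemma dmod1_repr (R : realType) (a b : R) :
  [/\ 0 <= dmod1 a b, 2 * dmod1 a b <= 1 &
  exists (s : bool) (z : int), a = b - (-1) ^+ s * dmod1 a b + z%:~R].
Proof.
rewrite /dmod1; set t := a - b; set fr := t - _.
have /andP[h1 h2] := floor_itv t; rewrite intrD in h2.
have f0 : 0 <= fr by rewrite subr_ge0.
have f1 : fr < 1 by rewrite /fr; lra.
have at' : a = b + t by rewrite /t; ring.
case: (leP fr (1 - fr)) => h; split; try lra.
  exists true, (Num.floor t); rewrite expr1 {1}at' /fr; ring.
exists false, (Num.floor t + 1); rewrite expr0 intrD {1}at' /fr; ring.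
Qed.

Lemma rank_sum (R : realType) (n : nat) (Y : nat -> R) (i : nat) :
  (rank n Y i)%:R = \sum_(j < n) (Y j.+1 <= Y i)%R%:R :> R.
Proof.
(* Index [0] is excluded by [rank] and contributes [0]. *)
rewrite /rank -sum1_card natr_sum big_mkcond big_ord_recl inE /= add0r.
by apply: eq_bigr => j _; rewrite inE /=; case: ifP.
Qed.

Lemma Mhat_sum (R : realType) (f : R -> R) (n : nat) (Y : nat -> R) (th : R) :
  (0 < n)%N ->
  n%:R ^+ 2 * Mhat f n Y th = \sum_(p : 'I_n * 'I_n)
    f (p.1.+1%:R / n%:R - th) * (Y p.2.+1 <= Y p.1.+1)%R%:R.
Proof.
move=> n0; have nn : n%:R != 0 :> R by rewrite pnatr_eq0 -lt0n.
rewrite /Mhat big_add1 /= big_mkord.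
rewrite -(pair_bigA _ (fun i j : 'I_n => f (i.+1%:R / n%:R - th) * (Y j.+1 <= Y i.+1)%R%:R)) /=.
rewrite !mulr_sumr; apply: eq_bigr => i _; rewrite -mulr_sumr -rank_sum.
by field.
Qed.

(** Used to round a parameter to the grid: the [n ^ 2] pairs have weights [0] or [1], so the average
    inherits the constant [L]. *)
Lemma Mhat_lipschitz (R : realType) (f : R -> R) (L : R) (n : nat) (Y : nat -> R)
    (th th' : R) : (0 < n)%N ->
  (forall x y, `|f x - f y| <= L * `|x - y|) ->
  `|Mhat f n Y th - Mhat f n Y th'| <= L * `|th - th'|.
Proof.
move=> n0 lip; have nn : 0 < n%:R ^+ 2 :> R by rewrite exprn_gt0 // ltr0n.
rewrite -(ler_pM2l nn) -{1}(gtr0_norm nn) -normrM mulrBr !Mhat_sum // -sumrB.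
apply: le_trans (ler_norm_sum _ _ _) _.
apply: (@le_trans _ _ (\sum_(p : 'I_n * 'I_n) (L * `|th - th'|))).
  apply: ler_sum => p _; rewrite -mulrBl normrM.
  have : `|f (p.1.+1%:R / n%:R - th) - f (p.1.+1%:R / n%:R - th')| <= L * `|th - th'|.
    apply: le_trans (lip _ _) _; rewrite (distrC th) le_eqVlt; apply/orP; left.
    by apply/eqP; congr (L * `|_|); ring.
  move=> h; rewrite -[leRHS]mulr1; apply: ler_pM => //.
  by case: (Y _ <= Y _); rewrite ?normr1 ?normr0.
by rewrite sumr_const card_prod !card_ord -[leLHS]mulr_natl natrM expr2.
Qed.

Lemma Mhat_periodic (R : realType) (f : R -> R) (n : nat) (Y : nat -> R) (th : R)
    (z : int) :
  (forall x, f (x + 1) = f x) -> Mhat f n Y (th + z%:~R) = Mhat f n Y th.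
Proof.
move=> per; rewrite /Mhat; congr (_ * _); apply: eq_bigr => i _; congr (_ * _).
by rewrite opprD addrA -mulrNz periodic_int.
Qed.

(** The smoothed score increases along [f] with slope of order [n], so [strong_rearrangement] bounds
    the sum by a negative multiple of [n] times the shift energy, which is at least of order
    [k ^ 2 / n]. *)
Lemma drift_le (R : realType) (f Psi : R -> R) (L c0 dl : R) :
  (forall x y, `|f x - f y| <= L * `|x - y|) ->
  (forall x, f (x + 1) = f x) ->
  (forall t, 4^-1 <= t <= 2^-1 -> exists x, f (x - t) != f x) ->
  0 < c0 -> 0 < dl ->
  (forall a b, a <= b -> Psi a <= Psi b) ->
  (forall a b, - dl <= a -> a <= b -> b <= dl -> c0 * (b - a) <= Psi b - Psi a) ->
  exists2 c, 0 < c & exists N, forall (n k : nat) (s : bool) (th : R),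
    let g (z : int) := f (z%:~R / n%:R - th) in (N <= n)%N -> (2 * k <= n)%N ->
    \sum_(1 <= i < n.+1) (\sum_(1 <= j < n.+1) Psi (g i%:Z - g j%:Z)) *
       (g (i%:Z + (-1) ^+ s * k%:Z) - g i%:Z) <= - (c * k%:R ^+ 2).
Proof.
move=> lip per gap c00 dl0 mono strong.
have [c1 c1_gt0 [N1 H1]] := shift_energy lip per gap.
have [c2 c2_gt0 [N2 H2]] := smoothed_score_strongly_monotone lip per c00 dl0 mono strong.
exists (c1 * c2 / 2); first by rewrite !mulr_gt0.
exists (maxn 1 (maxn N1 N2)) => n k s th g.
rewrite !geq_max => /andP[n0 /andP[Nn1 Nn2]] kn.
have nR : 0 < n%:R :> R by rewrite ltr0n.
have pg : forall z, g (z + n%:Z) = g z by exact: grid_periodic.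
pose u (z : int) := \sum_(1 <= j < n.+1) Psi (g z - g j%:Z).
have pu z : u (z + n%:Z) = u z by rewrite /u pg.
have uv i j : g i <= g j -> c2 * n%:R * (g j - g i) <= u j - u i.
  by move=> gij; have := H2 n th _ _ Nn2 gij; rewrite mulrAC.
apply: (le_trans (strong_rearrangement _ pu pg uv)).
have en : c1 * k%:R ^+ 2 / n%:R <=
    \sum_(1 <= i < n.+1) (g (i%:Z + (-1) ^+ s * k%:Z) - g i%:Z) ^+ 2.
  (* The backward shift has the energy of the forward one, by substituting [i + k] for [i]. *)
  case: s; last by rewrite expr0 mul1r; exact: H1.
  have pd z : (g (z + n%:Z + (-1) * k%:Z) - g (z + n%:Z)) ^+ 2 =
      (g (z + (-1) * k%:Z) - g z) ^+ 2 by rewrite addrAC !pg.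
  rewrite expr1 -(@sum_periodic_shift _ n
    (fun z => (g (z + (-1) * k%:Z) - g z) ^+ 2) pd k%:Z).
  apply: le_trans (H1 n k th Nn1 kn) _.
  rewrite le_eqVlt; apply/orP; left; apply/eqP; apply: eq_bigr => i _.
  rewrite -[RHS]sqrrN opprB /g; congr ((f (_%:~R / _ - _) - f (_%:~R / _ - _)) ^+ 2); ring.
rewrite mulNr lerN2; rewrite ler_pdivrMr // in en.
by have := ler_wpM2l (ltW c2_gt0) en; lra.
Qed.

(** * Increments of the centered criterion *)

Section Increments.
Context {d} {T : measurableType d} {R : realType} (P : probability T R).
Variables (Z : nat -> {RV P >-> R}) (phi : R -> R).
Hypothesis indep : mutually_independent P Z.
Hypothesis dens : forall i, has_density P (Z i) phi.
Variables (f : R -> R) (L thstar : R).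
Hypothesis lip : forall x y, `|f x - f y| <= L * `|x - y|.
Hypothesis per : forall x, f (x + 1) = f x.
Variable n : nat.
Hypothesis n0 : (0 < n)%N.

Definition grid (z : int) : R := f (z%:~R / n%:R - thstar).

Definition obs (w : T) (i : nat) : R := f (i%:R / n%:R - thstar) + Z i w.

Definition rank_event (p : 'I_n * 'I_n) : set T :=
  diff_le Z p.1.+1 p.2.+1 (grid p.1.+1 - grid p.2.+1).

(* [n ^ 2] times the increment, over one grid step in direction [s], of the
   centered criterion. *)
Definition increment (s : bool) (l : nat) (w : T) : R :=
  \sum_(p : 'I_n * 'I_n)
    (grid (p.1.+1%:Z + (-1) ^+ s * l.+1%:Z) - grid (p.1.+1%:Z + (-1) ^+ s * l%:Z)) *
    (\1_(rank_event p) w - fine (P (rank_event p))).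

Lemma indic_rank_event p w :
  \1_(rank_event p) w = (obs w p.2.+1 <= obs w p.1.+1)%R%:R :> R.
Proof.
rewrite indicE; congr (nat_of_bool _)%:R; apply/idP/idP.
  by rewrite inE /rank_event /diff_le /below_diagonal /obs /grid /=; lra.
by rewrite inE /rank_event /diff_le /below_diagonal /obs /grid /=; lra.
Qed.

Lemma grid_shift (s : bool) (k : nat) (i : int) :
  grid (i + (-1) ^+ s * k%:Z) = f (i%:~R / n%:R - (thstar - (-1) ^+ s * (k%:R / n%:R))).
Proof.
have nn : n%:R != 0 :> R by rewrite pnatr_eq0 -lt0n.
rewrite /grid intrD; congr f.
have -> : ((-1) ^+ s * k%:Z)%:~R = (-1) ^+ s * k%:R :> R.
  by rewrite intrM -pmulrn; case: s; rewrite ?expr0 ?expr1 ?mulrNz.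
by field.
Qed.

Lemma sum_increment s k w :
  \sum_(l < k) increment s l w =
  n%:R ^+ 2 * (Mhat f n (obs w) (thstar - (-1) ^+ s * (k%:R / n%:R))
               - Mhat f n (obs w) thstar) -
  \sum_(p : 'I_n * 'I_n)
    (grid (p.1.+1%:Z + (-1) ^+ s * k%:Z) - grid p.1.+1) * fine (P (rank_event p)).
Proof.
rewrite exchange_big /= mulrBr !Mhat_sum // -!sumrB; apply: eq_bigr => p _.
rewrite -mulr_suml -(big_mkord xpredT (fun l : nat =>
  grid (p.1.+1%:Z + (-1) ^+ s * l.+1%:Z) - grid (p.1.+1%:Z + (-1) ^+ s * l%:Z))).
rewrite telescope_sumr // mulr0 addr0 indic_rank_event.
by rewrite !grid_shift -!pmulrn /grid -pmulrn; ring.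
Qed.

(** A diagonal pair has probability [1] instead of [diff_cdf Z 0]. The excess [e] is the same for
    all [i], so it multiplies the sum of all increments of [grid], which vanishes by periodicity. *)
Lemma mean_criterion_increment s k :
  \sum_(p : 'I_n * 'I_n)
    (grid (p.1.+1%:Z + (-1) ^+ s * k%:Z) - grid p.1.+1) * fine (P (rank_event p)) =
  \sum_(1 <= i < n.+1) (\sum_(1 <= j < n.+1) diff_cdf Z (grid i%:Z - grid j%:Z)) *
    (grid (i%:Z + (-1) ^+ s * k%:Z) - grid i%:Z).
Proof.
pose e := 1 - diff_cdf Z 0.
have PE (i j : 'I_n) : fine (P (rank_event (i, j))) =
    diff_cdf Z (grid i.+1 - grid j.+1) + (i == j)%:R * e.
  rewrite /rank_event /=; have [<-|ij] := eqVneq i j.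
    rewrite subrr mul1r /e addrC subrK (_ : diff_le _ _ _ _ = setT) ?probability_setT //.
    apply/seteqP; split => // w _; by rewrite /diff_le /below_diagonal /= subrr.
  by rewrite mul0r addr0 (prob_diff_le indep dens) // eqSS.
pose D (i : nat) := grid (i%:Z + (-1) ^+ s * k%:Z) - grid i%:Z.
have D0 : \sum_(i < n) D i.+1 = 0.
  have := sum_periodic_shift (grid_periodic thstar per n0) ((-1) ^+ s * k%:Z).
  rewrite -/grid !big_add1 /= !big_mkord /D sumrB => <-.
  by apply/eqP; rewrite subr_eq0; apply/eqP/eq_bigr => i _; rewrite addrC.
rewrite big_add1 /= big_mkord.
rewrite -(pair_bigA _ (fun i j : 'I_n => D i.+1 * fine (P (rank_event (i, j))))) /=.
transitivity (\sum_(i < n) ((\sum_(1 <= j < n.+1) diff_cdf Z (grid i.+1%:Z - grid j%:Z)) *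
    D i.+1 + e * D i.+1)); last by rewrite big_split /= -mulr_sumr D0 mulr0 addr0.
apply: eq_bigr => i _; rewrite -mulr_sumr mulrC -mulrDl; congr (_ * _).
rewrite big_add1 /= big_mkord; under eq_bigr do rewrite PE.
rewrite big_split /=; congr (_ + _).
rewrite (bigD1 i) //= eqxx mul1r big1 ?addr0 // => j ji.
by rewrite eq_sym (negbTE ji) mul0r.
Qed.

Lemma bounded_measurable_increment s l : bounded_measurable (increment s l).
Proof.
apply: bounded_measurable_sum => p; apply: bounded_measurableM.
  exact: bounded_measurable_cst.
apply: bounded_measurableD; last exact: bounded_measurable_cst.
by apply: bounded_measurable_indic; exact: measurable_diff_le.
Qed.

(** One grid step changes [f] by at most [L / n], which is the bound on the coefficients in the rank
    fluctuation estimate. *)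
Lemma increment_second_moment s l :
  mean P (fun w => increment s l w ^+ 2) <= 4 * n%:R * L ^+ 2.
Proof.
have nR : 0 < n%:R :> R by rewrite ltr0n.
have bB (i : 'I_n) : `|grid (i.+1%:Z + (-1) ^+ s * l.+1%:Z) -
    grid (i.+1%:Z + (-1) ^+ s * l%:Z)| <= L / n%:R.
  rewrite !grid_shift; apply: le_trans (lip _ _) _.
  rewrite (_ : _ - _ = (-1) ^+ s / n%:R); last by rewrite -(natr1 l); ring.
  by rewrite normrM normrX normrN1 expr1n mul1r gtr0_norm // invr_gt0.
have := rank_fluctuation_second_moment indep dens
  (y := fun i => grid i.+1) (A := rank_event) (fun=> erefl) bB.
move/le_trans; apply; rewrite le_eqVlt; apply/orP; left; apply/eqP.
by field; rewrite gt_eqF.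
Qed.

(** Summing over both directions and all steps gives one variable that does not depend on the
    estimator. *)
Definition weighted_energy (m : R) (w : T) : R :=
  \sum_(s : bool) \sum_(l < n) increment s l w ^+ 2 / (m + l%:R) ^+ 2.

Lemma bounded_measurable_weighted_energy m : bounded_measurable (weighted_energy m).
Proof.
apply: bounded_measurable_sum => s; apply: bounded_measurable_sum => l.
apply: bounded_measurableM; last exact: bounded_measurable_cst.
by under eq_fun do rewrite expr2; apply: bounded_measurableM;
  exact: bounded_measurable_increment.
Qed.

Lemma weighted_energy_ge0 m w : 0 <= weighted_energy m w.
Proof. by do 2!apply: sumr_ge0 => ? _; rewrite divr_ge0 ?sqr_ge0. Qed.

Lemma mean_weighted_energy_le m : 1 <= m ->
  mean P (weighted_energy m) <= 16 * n%:R * L ^+ 2 / m.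
Proof.
move=> m1; have bV s l : bounded_measurable (fun w => increment s l w ^+ 2).
  by under eq_fun do rewrite expr2; apply: bounded_measurableM;
    exact: bounded_measurable_increment.
have bt s (l : 'I_n) : bounded_measurable
    (fun w => increment s l w ^+ 2 / (m + l%:R) ^+ 2).
  by apply: bounded_measurableM => //; exact: bounded_measurable_cst.
have half s : mean P (fun w => \sum_(l < n) increment s l w ^+ 2 / (m + l%:R) ^+ 2) <=
    8 * n%:R * L ^+ 2 / m.
  rewrite mean_sum //.
  apply: (@le_trans _ _ (4 * n%:R * L ^+ 2 * \sum_(l < n) ((m + l%:R) ^+ 2)^-1)); last first.
    have c0 : 0 <= 4 * n%:R * L ^+ 2 by rewrite mulr_ge0 ?sqr_ge0 ?mulr_ge0.
    by have := ler_wpM2l c0 (sum_inv_sqr_le n m1); lra.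
  rewrite mulr_sumr; apply: ler_sum => l _.
  rewrite (_ : (fun w => _) = (fun w => ((m + l%:R) ^+ 2)^-1 * increment s l w ^+ 2)).
    2: by apply/funext => w; rewrite mulrC.
  rewrite meanZ // mulrC ler_wpM2r ?invr_ge0 ?sqr_ge0 //.
  exact: increment_second_moment.
rewrite mean_sum; last by move=> s; apply: bounded_measurable_sum => l.
by rewrite big_bool /=; have := half true; have := half false; lra.
Qed.

End Increments.

(** * Consistency at rate [sqrt n] *)

Lemma shift_neq (R : realType) (f : R -> R) :
  (forall th th' : R, dmod1 th th' != 0 ->
     (0 < lebesgue_measure [set x : R | (f (x - th) != f (x - th'))%R])%E) ->
  forall t, 4^-1 <= t <= 2^-1 -> exists x, f (x - t) != f x.
Proof.
move=> exact_per t /andP[t1 t2]; apply: contrapT => /forallNP H.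
have fl : Num.floor t = 0.
  by apply/eqP; rewrite floor_eq; apply/andP; split; lra.
have d0 : dmod1 t 0 != 0.
  rewrite /dmod1 subr0 fl subr0; apply: lt0r_neq0.
  by rewrite lt_min; apply/andP; split; lra.
have := exact_per t 0 d0; rewrite (_ : [set x | _] = set0) ?measure0 ?ltxx //.
by apply/seteqP; split => x //=; rewrite subr0 => h; case: (H x).
Qed.

(** The estimator is rounded to [k] whole grid steps from [thstar]. By maximality the criterion
    drops there by at most [L / n], while its mean drops by at least [c * (k / n) ^ 2], which is at
    least twice as much; the centered increments make up the difference. *)
Lemma weighted_energy_of_deviation d (T : measurableType d) (R : realType)
    (P : probability T R) (Z : nat -> {RV P >-> R}) (phi f : R -> R)
    (L thstar th c C0 : R) (n : nat) (w : T) :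
  mutually_independent P Z -> (forall i, has_density P (Z i) phi) ->
  (forall x y, `|f x - f y| <= L * `|x - y|) ->
  (forall x, f (x + 1) = f x) -> 0 < c -> (0 < n)%N -> 1 <= C0 ->
  2 * L <= c * C0 ->
  (forall (k : nat) (s : bool), (2 * k <= n)%N ->
     let g := grid f thstar n in
     \sum_(1 <= i < n.+1) (\sum_(1 <= j < n.+1) diff_cdf Z (g i%:Z - g j%:Z)) *
       (g (i%:Z + (-1) ^+ s * k%:Z) - g i%:Z) <= - (c * k%:R ^+ 2)) ->
  Mhat f n (obs Z f thstar n w) thstar <= Mhat f n (obs Z f thstar n w) th ->
  C0 + 1 < Num.sqrt n%:R * dmod1 th thstar ->
  c ^+ 2 / 16 * (C0 * Num.sqrt n%:R) <=
    weighted_energy Z f thstar n (C0 * Num.sqrt n%:R) w.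
Proof.
move=> indep dens lip per c0 n0 C1 C0L drift opt dev.
have L0 := lipschitz_const_ge0 lip.
have nR : 0 < n%:R :> R by rewrite ltr0n.
set sn := Num.sqrt n%:R in dev *.
have snn : sn * sn = n%:R by rewrite -expr2 sqr_sqrtr // ltW.
have sn0 : 0 <= sn by rewrite sqrtr_ge0.
have n1 : 1 <= n%:R :> R by rewrite ler1n.
have sn1 : 1 <= sn by nra.
have [d0 d1 [s [z thE]]] := dmod1_repr th thstar.
set dd := dmod1 th thstar in d0 d1 dev thE.
have nd0 : 0 <= n%:R * dd by rewrite mulr_ge0 // ltW.
pose k := Num.truncn (n%:R * dd).
have /andP[k1 k2] := truncn_itv nd0; rewrite -/k -natr1 in k1 k2.
have kn : (2 * k <= n)%N by rewrite -(ler_nat R) natrM; nra.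
(* Rounding loses less than one step, hence less than [sn]: this is the [+ 1] in the threshold. *)
have mk : C0 * sn <= k%:R.
  have : (C0 + 1) * sn <= n%:R * dd by rewrite -snn mulrAC -mulrA mulrC ler_wpM2l //; lra.
  by nra.
have m0 : 0 < C0 * sn by rewrite mulr_gt0; lra.
set Y := obs Z f thstar n w in opt.
have thk : - (L * n%:R) <= n%:R ^+ 2 *
    (Mhat f n Y (thstar - (-1) ^+ s * (k%:R / n%:R)) - Mhat f n Y thstar).
  move: opt; rewrite thE Mhat_periodic // => opt.
  have := Mhat_lipschitz Y (thstar - (-1) ^+ s * dd) (thstar - (-1) ^+ s * (k%:R / n%:R)) n0 lip.
  rewrite (_ : thstar - _ - _ = (-1) ^+ s * (k%:R / n%:R - dd)); last by ring.
  rewrite normrM normrX normrN1 expr1n mul1r => h.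
  have kd : `|k%:R / n%:R - dd| <= n%:R^-1.
    rewrite -(ler_pM2l nR) divff ?gt_eqF // -{1}(gtr0_norm nR) -normrM mulrBr.
    rewrite mulrCA divff ?gt_eqF // mulr1 ler_norml; apply/andP; split; lra.
  have h' := le_trans h (ler_wpM2l L0 kd); move: h'.
  rewrite ler_norml => /andP[_ h'].
  have : - (L / n%:R) <= Mhat f n Y (thstar - (-1) ^+ s * (k%:R / n%:R)) - Mhat f n Y thstar by lra.
  move/(ler_wpM2l (sqr_ge0 n%:R)); apply: le_trans.
  by rewrite le_eqVlt; apply/orP; left; apply/eqP; field; rewrite gt_eqF.
have kL : L * n%:R <= c / 2 * k%:R ^+ 2.
  have : (C0 * sn) ^+ 2 <= k%:R ^+ 2 by rewrite ler_sqr ?nnegrE // ltW.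
  rewrite exprMn expr2 [sn ^+ 2]expr2 snn => h.
  have := ler_wpM2l (ltW c0) h.
  have : 2 * L * (C0 * n%:R) <= c * C0 * (C0 * n%:R).
    by rewrite ler_wpM2r // mulr_ge0 ?(ltW nR) //; lra.
  have : L * n%:R <= L * n%:R * C0 by rewrite ler_peMr // mulr_ge0 // ltW.
  by lra.
have W : c / 2 * k%:R ^+ 2 <= \sum_(l < k) increment Z f thstar n s l w.
  rewrite sum_increment // (mean_criterion_increment indep dens _ per n0).
  by have := drift k s kn => /=; lra.
have c20 : 0 < c / 2 by rewrite divr_gt0.
have kn' : (k <= n)%N by apply: leq_trans kn; rewrite leq_pmull.
have E := weighted_energy_ge (V := fun l => increment Z f thstar n s l w) c20 m0 mk kn' W.
apply: (@le_trans _ _ ((c / 2) ^+ 2 / 4 * k%:R)).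
  have := ler_wpM2l (sqr_ge0 c) mk; lra.
apply: (le_trans E); rewrite /weighted_energy (bigD1 s) //= lerDl.
by do 2!apply: sumr_ge0 => ? _; rewrite divr_ge0 ?sqr_ge0.
Qed.

Theorem theorem2 (R : realType) (f : R -> R) (thstar : R) (phi : R -> R)
  (d : measure_display) (T : measurableType d) (P : probability T R)
  (Z : nat -> {RV P >-> R}) (thetahat : nat -> T -> R) :
  (* f Lipschitz continuous *)
  (exists L : R, forall x y, `|f x - f y| <= L * `|x - y|) ->
  (* f 1-periodic *)
  (forall x, f (x + 1) = f x) ->
  (* f exactly 1-periodic *)
  (forall th th' : R, dmod1 th th' != 0 ->
     (0 < lebesgue_measure [set x : R | (f (x - th) != f (x - th'))%R])%E) ->
  (* Z_i iid with even density phi *)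
  mutually_independent P Z ->
  (forall i, has_density P (Z i) phi) ->
  (forall z, phi (- z) = phi z) ->
  (* theta* is the unique maximum point of M modulo 1 *)
  (forall th, Mpop f phi thstar th <= Mpop f phi thstar thstar) ->
  (forall th, Mpop f phi thstar th = Mpop f phi thstar thstar ->
     dmod1 th thstar = 0) ->
  (* thetahat n maximizes hat M_n, with Y_i = f(i/n - theta* ) + Z_i *)
  (forall (n : nat) (w : T) (th : R),
     Mhat f n (fun i => f (i%:R / n%:R - thstar) + Z i w) th
       <= Mhat f n (fun i => f (i%:R / n%:R - thstar) + Z i w) (thetahat n w)) ->
  (* sqrt n * d(thetahat n, theta* ) is bounded in (outer) probability *)
  forall eps : R, 0 < eps ->
    exists C : R, exists N : nat, forall n : nat, (N <= n)%N ->
      exists A : set T, measurable A /\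
        [set w | C < Num.sqrt n%:R * dmod1 (thetahat n w) thstar] `<=` A /\
        (P A < eps%:E)%E.
Proof.
move=> [L lip] per exact_per indep dens _ _ _ opt eps eps0.
have L0 := lipschitz_const_ge0 lip.
have [c1 [dl [c10 dl0 strong]]] := diff_cdf_strong indep dens.
have [c c0 [N drift]] := drift_le lip per (shift_neq exact_per) c10 dl0
  (diff_cdf_mono indep dens) strong.
have eL0 : 0 <= 2 * L / c by rewrite divr_ge0 ?mulr_ge0 // ltW.
have ee0 : 0 <= 256 * L ^+ 2 / (c ^+ 2 * eps).
  by rewrite divr_ge0 ?mulr_ge0 ?sqr_ge0 // ltW.
(* The three terms serve [1 <= m], the rounding error and the Markov bound. *)
pose C0 := 1 + 2 * L / c + 256 * L ^+ 2 / (c ^+ 2 * eps).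
have C1 : 1 <= C0 by rewrite /C0; lra.
have C0L : 2 * L <= c * C0.
  by rewrite [leRHS]mulrC -ler_pdivrMr // /C0; lra.
have C0e : 256 * L ^+ 2 < C0 ^+ 2 * (c ^+ 2 * eps).
  have ce : 0 < c ^+ 2 * eps by rewrite mulr_gt0 ?exprn_gt0.
  rewrite -ltr_pdivrMr //; apply: (@lt_le_trans _ _ C0); first by rewrite /C0; lra.
  by nra.
exists (C0 + 1), (maxn 1 N) => n; rewrite geq_max => /andP[n0 Nn].
have nR : 0 < n%:R :> R by rewrite ltr0n.
pose m := C0 * Num.sqrt n%:R.
have snn : Num.sqrt n%:R ^+ 2 = n%:R :> R by rewrite sqr_sqrtr // ltW.
have n1 : 1 <= n%:R :> R by rewrite ler1n.
have sn1 : 1 <= Num.sqrt n%:R :> R.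
  by have := sqrtr_ge0 (n%:R : R); move: snn; rewrite expr2; nra.
have m1 : 1 <= m by rewrite /m; nra.
(* The Markov bound is [16 * n * L ^ 2 / (m * tau) = 256 * L ^ 2 / (c * C0) ^ 2 < eps]. *)
pose tau := c ^+ 2 / 16 * m.
have tau0 : 0 < tau by rewrite mulr_gt0 ?divr_gt0 ?exprn_gt0 //; lra.
have bE := bounded_measurable_weighted_energy Z f thstar n m.
have mA := measurable_superlevel tau bE.
(* This measurable event contains the deviation event for every choice of maximizer. *)
exists [set w | tau <= weighted_energy Z f thstar n m w]; split => //; split.
  move=> w /= dev; apply: (weighted_energy_of_deviation indep dens lip per c0 n0 C1 C0L) dev.
    by move=> k s kn; exact: drift.
  exact: opt.
have := mean_markov P tau bE (weighted_energy_ge0 Z f thstar n m).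
have := mean_weighted_energy_le indep dens thstar lip n0 m1.
move=> h1 h2; have {h1 h2} h := le_trans h2 h1.
rewrite -[ltLHS]fineK ?fin_num_measure // lte_fin.
rewrite -(ltr_pM2l tau0); apply: le_lt_trans h _.
have m0 : 0 < m by lra.
rewrite ltr_pdivrMr // /tau.
rewrite (_ : _ * m = c ^+ 2 * eps / 16 * m ^+ 2); last by ring.
rewrite /m exprMn snn.
have := C0e; rewrite -(ltr_pM2r nR); lra.
Qed.
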